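(* (Self-consistency of nonlinear equilibria, convex case.) Let $d\in\mathbb{N}$, $\Omega=\{1,\ldots,d\}^{\mathbb{N}}$, let $A:\Omega\to\mathbb{R}$ be a Hölder potential and let $F:\mathbb{R}\to\mathbb{R}$ be convex (hence continuous). (1) Let $\varpi\in\mathcal{P}(T)$ be a nonlinear equilibrium probability for $A$ and $F$, and suppose that $\bar s\in\mathbb{R}$ attains the supremum in $F(\varpi(A))=\sup_{s\in\mathbb{R}}\{s\varpi(A)-F^*(s)\}$. Then $\varpi$ is the unique linear equilibrium probability for the potential $\bar sA$, and $\bar s$ is a maximizer of the function $s\mapsto-F^*(s)+P(sA)-\log d$ on $\mathbb{R}$. If moreover $F^*$ is differentiable, then $$\varpi(A)=\left.\frac{d}{ds}P(sA)\right|_{s=\bar s}=(F^* )'(\bar s).$$ If in addition $(F^* )'$ is injective (i.e. $F^*$ is strictly convex) and $\chi$ denotes the inverse of $(F^* )'$ on its image, then $$\left.\frac{d}{ds}P(sA)\right|_{s=\chi(\varpi(A))}=\varpi(A)$$ and $\varpi$ is the linear equilibrium probability for the potential $\chi(\varpi(A))A$. (2) Conversely, suppose $F^*$ is differentiable with $(F^* )'$ injective, with inverse $\chi$ on its image, and let $\bar s\in\mathbb{R}$ be any maximizer of $s\mapsto-F^*(s)+P(sA)-\log d$. Then the unique linear equilibrium probability $\varpi$ for $\bar sA$ satisfies $\bar s=\chi(\varpi(A))$ and is a nonlinear equilibrium probability for $A$ and $F$.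
   Context: $T:\Omega\to\Omega$ is the shift $T(x_1,x_2,\ldots)=(x_2,x_3,\ldots)$; $\Omega$ carries the metric $d(x,y)=2^{-\min\{n:\,x_n\neq y_n\}}$, and ''Hölder'' refers to this metric. $\mathcal{P}(T)$ is the set of $T$-invariant Borel probabilities on $\Omega$; $h(\rho)$ is the Kolmogorov-Sinai entropy; $\rho(A)=\int A\,\mathrm{d}\rho$. The linear pressure is $P(B)=\sup_{\rho\in\mathcal{P}(T)}\{\rho(B)+h(\rho)\}$; its maximizers are the linear equilibrium probabilities for $B$ (unique when $B$ is Hölder). A nonlinear equilibrium probability for $A$ and $F$ is any $\rho\in\mathcal{P}(T)$ attaining $\sup_{\rho\in\mathcal{P}(T)}\{F(\rho(A))+h(\rho)\}$. $F^*(s)=\sup_{x\in\mathbb{R}}\{sx-F(x)\}\in\mathbb{R}\cup\{\infty\}$ is the Legendre-Fenchel transform; ''differentiable'' means finite and differentiable on $\mathbb{R}$. *)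

(* Defs.v *)
From HB Require Import structures.
From mathcomp Require Import all_boot all_order all_algebra.
From mathcomp Require Import all_classical all_reals all_analysis.
Import Order.TTheory GRing.Theory Num.Theory.
Import numFieldNormedType.Exports.

Set Implicit Arguments.
Unset Strict Implicit.
Unset Printing Implicit Defensive.

Local Open Scope classical_set_scope.
Local Open Scope ring_scope.

(* The full shift on d.+1 >= 1 symbols: the coordinate x_n (n >= 1) of a
   sequence is [x n.-1].  The parameter [R] is only there to determine the
   field in which the distance takes its values. *)
Definition shift_space (R : realType) (d : nat) : Type := nat -> 'I_d.+1.

Section shift_space_metric.
Context {R : realType} {d : nat}.
Local Notation Omega := (shift_space R d).
Implicit Types x y z : Omega.

(* 2 ^ - min {n >= 1 | x_n <> y_n}, hence the successor on the 0-based index *)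
Definition shift_dist x y : R :=
  match pselect (exists n, x n != y n) with
  | left xy => 2 ^- (ex_minn xy).+1
  | right _ => 0
  end.

Lemma shift_dist_lt_agree x y n : shift_dist x y < 2 ^- n ->
  forall i, (i < n)%N -> x i = y i.
Proof.
rewrite /shift_dist; case: pselect => [xy|xy _ i _]; last first.
  by apply/eqP/negPn/negP => xyi; apply: xy; exists i.
case: ex_minnP => m _ mmin; rewrite ltf_pV2 ?posrE ?exprn_gt0//.
rewrite ltr_eXn2l ?ltr1n// ltnS => nm i ni.
by apply/eqP/negPn/negP => /mmin; rewrite leqNgt (leq_trans ni nm).
Qed.

Lemma shift_dist_ge0 x y : 0 <= shift_dist x y.
Proof. by rewrite /shift_dist; case: pselect => // ?; rewrite invr_ge0 exprn_ge0. Qed.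

Lemma shift_distxx x : shift_dist x x = 0.
Proof.
by rewrite /shift_dist; case: pselect => // xx; exfalso; case: xx => n; rewrite eqxx.
Qed.

Lemma shift_dist_positivity x y : shift_dist x y = 0 -> x = y.
Proof.
rewrite /shift_dist; case: pselect => [xy /eqP|xy _].
  by rewrite invr_eq0 expf_eq0 /= pnatr_eq0.
by apply/funext => n; apply/eqP/negPn/negP => xyn; apply: xy; exists n.
Qed.

Lemma shift_dist_sym x y : shift_dist x y = shift_dist y x.
Proof.
rewrite /shift_dist; case: pselect => [xy|xy]; case: pselect => [yx|yx] //.
- by congr (2 ^- _.+1); apply: eq_ex_minn => n; rewrite eq_sym.
- by exfalso; case: xy => k xyk; apply: yx; exists k; rewrite eq_sym.
- by exfalso; case: yx => k yxk; apply: xy; exists k; rewrite eq_sym.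
Qed.

Lemma shift_dist_triangle y x z :
  shift_dist x z <= shift_dist x y + shift_dist y z.
Proof.
rewrite {1}/shift_dist; case: pselect => [xz|_]; last first.
  by rewrite addr_ge0 ?shift_dist_ge0.
case: ex_minnP => m xzm _; rewrite leNgt; apply/negP => xyz.
have xym : x m = y m.
  apply: (@shift_dist_lt_agree _ _ m.+1) => //; apply: le_lt_trans xyz.
  by rewrite lerDl shift_dist_ge0.
have yzm : y m = z m.
  apply: (@shift_dist_lt_agree _ _ m.+1) => //; apply: le_lt_trans xyz.
  by rewrite lerDr shift_dist_ge0.
by move: xzm; rewrite xym yzm eqxx.
Qed.

HB.instance Definition _ := Choice.copy Omega (nat -> 'I_d.+1).
HB.instance Definition _ := isPointed.Build Omega (fun=> ord0).
HB.instance Definition _ := isMetric.Build R Omega shift_distxx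
  shift_dist_positivity shift_dist_sym shift_dist_triangle.

(* the Borel sigma-algebra of the metric topology *)
HB.instance Definition _ := @isMeasurable.Build (sigma_display (@open Omega))
  Omega <<s @open Omega >> (@sigma_algebra0 _ setT (@open Omega))
  (@sigma_algebraC _ (@open Omega)) (@sigma_algebra_bigcup _ setT (@open Omega)).

Definition shift_map (x : Omega) : Omega := fun n => x n.+1.

End shift_space_metric.

Definition hoelder_potential {R : realType} {M : metricType R} (A : M -> R) :=
  exists alpha C : R, [/\ 0 < alpha <= 1, 0 <= C &
    forall x y : M, `|A x - A y| <= C * mdist x y `^ alpha].

Section entropy.
Context {dsp : measure_display} {X : measurableType dsp} {R : realType}.
Variables (mu : probability X R) (T : X -> X).

(* A finite measurable partition is encoded by its labelling function
   [xi : X -> I], whose fibers are the cells (possibly empty). *)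
Definition measurable_partition (I : finType) (xi : X -> I) :=
  forall i, measurable (xi @^-1` [set i]).

(* [ln 0 = 0], so that empty cells contribute 0 *)
Definition partition_entropy (I : finType) (xi : X -> I) : R :=
  - \sum_(i : I) fine (mu (xi @^-1` [set i])) * ln (fine (mu (xi @^-1` [set i]))).

(* the join of xi, T^-1 xi, ..., T^-(n-1) xi *)
Definition partition_join (I : finType) (xi : X -> I) (n : nat) :
    X -> {ffun 'I_n -> I} :=
  fun x => [ffun j : 'I_n => xi (iter j T x)].

Definition entropy_of_partition (I : finType) (xi : X -> I) : R :=
  limn (fun n => partition_entropy (partition_join xi n) / n%:R : R).

Definition ks_entropy : \bar R :=
  ereal_sup [set h | exists k (xi : X -> 'I_k),
    measurable_partition xi /\ h = (entropy_of_partition xi)%:E].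

End entropy.

Section thermodynamic_formalism.
Context {R : realType} {d : nat}.
Local Notation Omega := (shift_space R d).
Implicit Types (A B : Omega -> R) (rho : probability Omega R).

Definition shift_invariant rho :=
  forall U : set Omega, measurable U -> rho (shift_map @^-1` U) = rho U.

Definition pressure B : \bar R :=
  ereal_sup [set ((\int[rho]_x B x)%:E + ks_entropy rho shift_map)%E
            | rho in [set rho : probability Omega R | shift_invariant rho]].

Definition linear_equilibrium B rho :=
  shift_invariant rho /\
  ((\int[rho]_x B x)%:E + ks_entropy rho shift_map)%E = pressure B.

(* Two measures are identified when they agree on the measurable sets, since a
   [probability] is a function on all sets, unconstrained on the others. *)
Definition unique_linear_equilibrium B rho :=
  linear_equilibrium B rho /\
  forall rho', linear_equilibrium B rho' ->
    forall U : set Omega, measurable U -> rho' U = rho U.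

Definition nonlinear_pressure A (F : R -> R) : \bar R :=
  ereal_sup [set ((F (\int[rho]_x A x))%:E + ks_entropy rho shift_map)%E
            | rho in [set rho : probability Omega R | shift_invariant rho]].

Definition nonlinear_equilibrium A (F : R -> R) rho :=
  shift_invariant rho /\
  ((F (\int[rho]_x A x))%:E + ks_entropy rho shift_map)%E = nonlinear_pressure A F.

(* s |-> P(sA); for a Hoelder A the pressure is finite and [fine] is harmless *)
Definition pressure_fun A (s : R) : R := fine (pressure (fun x => s * A x)).

End thermodynamic_formalism.

Section legendre.
Context {R : realType}.
Implicit Types (F : R -> R) (s : R).

Definition legendre F s : \bar R :=
  ereal_sup [set (s * x - F x)%:E | x in [set: R]].

(* the real values of F^*, meaningful where F^* is finite *)
Definition legendre_fun F s : R := fine (legendre F s).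

Definition legendre_differentiable F :=
  (forall s, legendre F s \is a fin_num) /\
  (forall s, derivable (legendre_fun F) s 1).

End legendre.

Definition maximizer {R : realType} (g : R -> \bar R) (s : R) :=
  forall t, (g t <= g s)%E.

(* s |-> - F^*(s) + P(sA) - log(number of symbols) *)
Definition dual_functional {R : realType} {d : nat} (A : shift_space R d -> R)
    (F : R -> R) (s : R) : \bar R :=
  (- legendre F s + pressure (fun x => (s * A x)%R) - (ln d.+1%:R)%:E)%E.

(* Main.v *)
Require Import Defs.
From HB Require Import structures.
From mathcomp Require Import all_boot all_order all_algebra.
From mathcomp Require Import all_classical all_reals all_analysis.
From mathcomp Require Import ring lra.
Import Order.TTheory GRing.Theory Num.Theory.
Import numFieldNormedType.Exports.

(* A Hoelder potential [B] has a unique linear equilibrium state: approximate fixed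
   points of the discounted log-sum-exp operator have an ultralimit [f] with
   [sum_a exp (B (a x) + f (a x) - f x - l) = 1], so that up to a coboundary and the
   constant [l] the potential is the logarithm [G] of a g-function.  Since [h (rho)] is
   the limit of conditional entropies of x_1 given (x_2, ..., x_n) (Kolmogorov-Sinai),
   [h (rho) + rho (G)] is minus a limit of relative entropies, hence nonpositive, and
   by Pinsker's inequality it vanishes only if [rho] is fixed by the dual of the Ruelle
   operator of [G].  The iterates of that operator contract Hoelder functions to
   constants, which gives both the existence and the uniqueness of such a [rho].

   The rest is convex duality.  The values at a pair (s, rho) of
   [s rho (A) + h (rho) - F^* (s)] are maximised over rho for fixed s by
   [P (s A) - F^* (s)] and over s for fixed rho by [F (rho (A)) + h (rho)], so
   maximisers of one problem give maximisers of the other.  At a maximiser [sbar] with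
   equilibrium state [rho],
     [(s - sbar) rho (A) <= P (s A) - P (sbar A) <= F^* (s) - F^* (sbar)],
   and differentiability of [F^*] forces that of the pressure, with equal derivatives. *)

Set Implicit Arguments.
Unset Strict Implicit.
Unset Printing Implicit Defensive.

Local Open Scope classical_set_scope.
Local Open Scope ring_scope.

(** * Entropy of finite partitions *)

(** The equilibrium state is constructed rather than extracted by compactness of the invariant
    measures: the iterates of the normalised operator on the indicator of a cylinder tend to a
    constant, and these constants are the weights of the measure. Entropies and integrals are
    handled as finite sums over words, a function of variation C th^n being replaced by its value at
    one point of each cylinder. Let p be the law of (x_1, ..., x_{n+1}) under rho, and q the law
    with the same (x_2, ..., x_{n+1}) but with x_1 drawn according to exp G. The n-th entropy
    increment plus the p-mean of G is exactly minus the relative entropy of p with respect to q;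
    normalising the potential is what makes q a probability vector. For the sup norm the operator is
    merely nonexpansive. The contraction comes from a cone of positive functions with controlled
    logarithmic variation: the operator improves the control, and this gain pays for removing a
    constant. *)

Lemma ln_ge1BV {R : realType} (x : R) : 0 < x -> 1 - x^-1 <= ln x.
Proof.
move=> x0; have xV : 0 < x^-1 by rewrite invr_gt0.
have := @le_ln1Dx R (x^-1 - 1); rewrite [1 + _]addrC subrK lnV ?posrE// => h.
by have := h (ltac:(lra)); lra.
Qed.

Lemma expR_sub1_le {R : realType} (x : R) : expR x - 1 <= x * expR x.
Proof.
have h : (1 - x) * expR x <= expR (- x) * expR x.
  by rewrite ler_pM2r ?expR_gt0// expR_ge1Dx.
by move: h; rewrite -expRD addNr expR0; lra.
Qed.

Section labellings.
Context {dsp : measure_display} {X : measurableType dsp} {R : realType}.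
Variable mu : probability X R.

Lemma preimage_label_measurable (I : finType) (xi : X -> I) (P : set I) :
  measurable_partition xi -> measurable (xi @^-1` P).
Proof.
move=> mxi; rewrite (_ : _ @^-1` _ = \bigcup_(i in P) xi @^-1` [set i]).
  by apply: fin_bigcup_measurable.
apply/seteqP; split => [x /= Px|x [i Pi /= ->]//].
by exists (xi x).
Qed.

Lemma measurable_partition_factor (I J : finType) (f : I -> J) (xi : X -> I) :
  measurable_partition xi -> measurable_partition (f \o xi).
Proof.
move=> mxi j; rewrite comp_preimage; exact: preimage_label_measurable.
Qed.

Lemma measurable_partition_pair (I J : finType) (xi : X -> I) (eta : X -> J) :
  measurable_partition xi -> measurable_partition eta ->
  measurable_partition (fun x => (xi x, eta x)).
Proof.
move=> mxi meta [i j].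
rewrite (_ : _ @^-1` _ = xi @^-1` [set i] `&` eta @^-1` [set j]).
  exact: measurableI.
by apply/seteqP; split => x /= => [[-> ->]|[-> ->]].
Qed.

Definition weight (I : finType) (xi : X -> I) (i : I) : R :=
  fine (mu (xi @^-1` [set i])).

Lemma fine_probability_ge0 (U : set X) : 0 <= fine (mu U).
Proof. exact/fine_ge0/measure_ge0. Qed.

Lemma weight_ge0 (I : finType) (xi : X -> I) i : 0 <= weight xi i.
Proof. exact: fine_probability_ge0. Qed.

Lemma fine_probability_le (U V : set X) : measurable U -> measurable V ->
  U `<=` V -> fine (mu U) <= fine (mu V).
Proof.
move=> mU mV UV; apply: fine_le; rewrite ?fin_num_measure//.
by apply: le_measure; rewrite ?inE.
Qed.

Lemma fine_probabilityU (U V : set X) : measurable U -> measurable V ->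
  U `&` V = set0 -> fine (mu (U `|` V)) = fine (mu U) + fine (mu V).
Proof.
by move=> mU mV UV; rewrite measureU// fineD// fin_num_measure.
Qed.

Lemma fine_probability_label (I : finType) (xi : X -> I) (U : set X)
    (P : pred I) : measurable_partition xi -> measurable U ->
  fine (mu (U `&` xi @^-1` [set i | P i])) =
  \sum_(i | P i) fine (mu (U `&` xi @^-1` [set i])).
Proof.
move=> mxi mU; rewrite -big_filter.
have -> : [set i | P i] = [set` [seq i <- index_enum I | P i]].
  by apply/seteqP; split => i /=; rewrite mem_filter mem_index_enum andbT.
elim: [seq _ <- _ | _] (filter_uniq P (index_enum_uniq I)) => [_|i s IHs].
  by rewrite big_nil set_nil preimage_set0 setI0 measure0.
move=> /= /andP[si us]; rewrite big_cons -IHs//.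
rewrite (_ : [set` i :: s] = [set i] `|` [set` s]); last first.
  apply/seteqP; split => j /=; rewrite inE; first by move=> /predU1P.
  by case=> [->|->]; rewrite ?eqxx ?orbT.
rewrite preimage_setU setIUr.
rewrite fine_probabilityU//; try by apply: measurableI => //; exact: preimage_label_measurable.
apply/seteqP; split => // x [[_ /= xi_i] [_ /=]].
by rewrite xi_i (negbTE si).
Qed.

Lemma weight_factor (I J : finType) (f : I -> J) (xi : X -> I) j :
  measurable_partition xi ->
  weight (f \o xi) j = \sum_(i | f i == j) weight xi i.
Proof.
move=> mxi; rewrite /weight.
have := fine_probability_label (fun i => f i == j) mxi measurableT.
rewrite setTI (_ : _ @^-1` _ = (f \o xi) @^-1` [set j]); last first.
  by apply/seteqP; split => x /= /eqP.
by move=> ->; apply: eq_bigr => i _; rewrite setTI.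
Qed.

Lemma sum_weight (I : finType) (xi : X -> I) : measurable_partition xi ->
  \sum_i weight xi i = 1.
Proof.
move=> mxi; have := fine_probability_label predT mxi measurableT.
rewrite setTI (_ : _ @^-1` _ = setT); last by apply/seteqP; split.
rewrite probability_setT /= => ->.
by apply: eq_bigr => i _; rewrite setTI.
Qed.

(** Indexing the entropy of a coarser labelling by the cells of the finer one allows a term by term
    comparison of different factors of [xi]. *)
Lemma partition_entropy_factor (I J : finType) (f : I -> J) (xi : X -> I) :
  measurable_partition xi ->
  partition_entropy mu (f \o xi) =
  - \sum_i weight xi i * ln (weight (f \o xi) (f i)).
Proof.
move=> mxi; rewrite /partition_entropy; congr (- _).
rewrite [RHS](partition_big f predT)//=; apply: eq_bigr => j _.
rewrite -/(weight (f \o xi) j) {1}weight_factor// mulr_suml.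
by apply: eq_bigr => i /eqP ->.
Qed.

Lemma weight_le_factor (I J : finType) (f : I -> J) (xi : X -> I) i :
  measurable_partition xi -> weight xi i <= weight (f \o xi) (f i).
Proof.
move=> mxi; apply: fine_probability_le => //.
  exact: measurable_partition_factor.
by move=> x /= ->.
Qed.

Lemma partition_entropy_comp_le (I J : finType) (f : I -> J) (xi : X -> I) :
  measurable_partition xi ->
  partition_entropy mu (f \o xi) <= partition_entropy mu xi.
Proof.
move=> mxi; rewrite partition_entropy_factor// lerN2.
apply: ler_sum => i _; rewrite -/(weight xi i).
have [->|p0] := eqVneq (weight xi i) 0; first by rewrite !mul0r.
have p_gt0 : 0 < weight xi i by rewrite lt0r p0 weight_ge0.
rewrite ler_pM2l// ler_ln ?posrE ?weight_le_factor//.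
exact: lt_le_trans (weight_le_factor _ _ _).
Qed.

(** Refinement is stated below as inclusion of kernels; this recovers a map between labels, with a
    junk value on labels that are not attained. *)
Lemma label_factor (I J : finType) (xi : X -> I) (eta : X -> J) :
  (forall x y, xi x = xi y -> eta x = eta y) ->
  exists f : I -> J, eta = f \o xi.
Proof.
move=> xieta.
pose f i := if pselect (exists x, xi x = i) is left h then eta (projT1 (cid h))
            else eta point.
exists f; apply/funext => x /=; rewrite /f; case: pselect => [h|[]]; last by exists x.
by apply: xieta; case: cid.
Qed.

Lemma measurable_partition_le (I J : finType) (xi : X -> I) (eta : X -> J) :
  measurable_partition xi -> (forall x y, xi x = xi y -> eta x = eta y) ->
  measurable_partition eta.
Proof. by move=> mxi /label_factor[f ->]; exact: measurable_partition_factor. Qed.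

Lemma partition_entropy_le (I J : finType) (xi : X -> I) (eta : X -> J) :
  measurable_partition xi -> (forall x y, xi x = xi y -> eta x = eta y) ->
  partition_entropy mu eta <= partition_entropy mu xi.
Proof. by move=> mxi /label_factor[f ->]; exact: partition_entropy_comp_le. Qed.

Lemma partition_entropy_eq (I J : finType) (xi : X -> I) (eta : X -> J) :
  measurable_partition xi -> measurable_partition eta ->
  (forall x y, xi x = xi y <-> eta x = eta y) ->
  partition_entropy mu eta = partition_entropy mu xi.
Proof.
move=> mxi meta xieta; apply/eqP; rewrite eq_le.
by rewrite !partition_entropy_le// => x y /xieta.
Qed.

(** With p the law of (a, b, c), the difference of the two sides is the sum of p ln (p / q), where q
    = p(a, b) p(b, c) / p(b) makes a and c independent given b. Since ln x >= 1 - 1 / x, it is at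
    least the sum of p - q. *)
Lemma partition_entropy_submodular (I J K : finType) (a : X -> I) (b : X -> J)
    (c : X -> K) :
  measurable_partition a -> measurable_partition b -> measurable_partition c ->
  partition_entropy mu (fun x => (a x, b x, c x)) + partition_entropy mu b <=
  partition_entropy mu (fun x => (a x, b x)) +
  partition_entropy mu (fun x => (b x, c x)).
Proof.
move=> ma mb mc.
have mab := measurable_partition_pair ma mb.
have mbc := measurable_partition_pair mb mc.
set abc := fun x => (a x, b x, c x).
have mabc : measurable_partition abc := measurable_partition_pair mab mc.
pose q (t : I * J * K) := weight (fun x => (a x, b x)) t.1 *
  weight (fun x => (b x, c x)) (t.1.2, t.2) / weight b t.1.2.
have sumq : \sum_t q t <= 1.
  rewrite (eq_bigr (fun t => q (t.1, t.2))); last by move=> [].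
  rewrite -(pair_bigA _ (fun u k => q (u, k)))/=.
  have qk u : \sum_k q (u, k) <= weight (fun x => (a x, b x)) u.
    rewrite /q/= -mulr_suml -mulr_sumr.
    rewrite (_ : \sum_k _ = weight b u.2); last first.
      rewrite (_ : b = fst \o (fun x => (b x, c x)))// weight_factor//.
      rewrite (eq_bigl (fun t => (t.1 == u.2) && true)); last by move=> ?; rewrite andbT.
      rewrite (eq_bigr (fun t => weight (fun x => (b x, c x)) (t.1, t.2))); last by move=> [].
      rewrite -(pair_big (fun j => j == u.2) predT (fun j k => weight (fun x => (b x, c x)) (j, k)))/=.
      by rewrite big_pred1_eq.
    (* On a cell of [b] of weight 0, [q] vanishes because [0^-1 = 0]; hence an inequality only. *)
    have [->|b0] := eqVneq (weight b u.2) 0; first by rewrite invr0 mulr0 weight_ge0.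
    by rewrite mulfK.
  by apply: (le_trans (ler_sum _ (fun u _ => qk u))); rewrite sum_weight.
rewrite -subr_ge0.
rewrite (_ : (fun x => (a x, b x)) = fst \o abc)// (_ : b = snd \o (fst \o abc))//.
rewrite (_ : (fun x => (_, c x)) = (fun t : I * J * K => (t.1.2, t.2)) \o abc)//.
rewrite [partition_entropy mu abc](_ : _ = partition_entropy mu (id \o abc))//.
rewrite compA !partition_entropy_factor//.
have oppE (s1 s2 s3 s4 : R) : - s1 - s2 - (- s3 - s4) = s3 + s4 - (s1 + s2) by ring.
rewrite oppE -!big_split/= -sumrB.
apply: (@le_trans _ _ (\sum_t (weight abc t - q t))).
  by rewrite sumrB sum_weight// subr_ge0.
apply: ler_sum => t _.
have qE : q t = weight (fst \o abc) t.1 * weight ((fun t : I * J * K => (t.1.2, t.2)) \o abc) (t.1.2, t.2) / weight ((snd \o fst) \o abc) t.1.2.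
  by [].
have q0 : 0 <= q t by rewrite qE !(mulr_ge0, invr_ge0)// weight_ge0.
rewrite -!mulrDr -mulrBr.
have [->|p0] := eqVneq (weight abc t) 0; first by rewrite !mul0r sub0r oppr_le0.
have p_gt0 : 0 < weight abc t by rewrite lt0r p0 weight_ge0.
have gt0 (L : finType) (f : I * J * K -> L) : 0 < weight (f \o abc) (f t).
  exact: lt_le_trans (weight_le_factor _ _ _).
have h1 := gt0 _ fst; have h2 := gt0 _ (snd \o fst).
have h3 := gt0 _ (fun t : I * J * K => (t.1.2, t.2)).
have q_gt0 : 0 < q t by rewrite qE divr_gt0// mulr_gt0.
rewrite (_ : weight abc t - q t = weight abc t * (1 - (weight abc t / q t)^-1)); last first.
  by rewrite invf_div mulrBr mulr1 mulrCA divff ?mulr1.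
rewrite ler_pM2l//; apply: le_trans (ln_ge1BV _) _; first by rewrite divr_gt0.
rewrite ln_div ?posrE// qE ln_div ?posrE ?mulr_gt0// lnM ?posrE//=.
rewrite /=; lra.
Qed.

End labellings.

(** * Conditional entropy *)

Section conditional_entropy.
Context {dsp : measure_display} {X : measurableType dsp} {R : realType}.
Variable mu : probability X R.

Definition conditional_entropy (I J : finType) (a : X -> I) (b : X -> J) : R :=
  partition_entropy mu (fun x => (a x, b x)) - partition_entropy mu b.

Lemma conditional_entropy_ge0 (I J : finType) (a : X -> I) (b : X -> J) :
  measurable_partition a -> measurable_partition b ->
  0 <= conditional_entropy a b.
Proof.
move=> ma mb; rewrite subr_ge0 partition_entropy_le//.
  exact: measurable_partition_pair.
by move=> x y [].
Qed.

(** Submodularity with the coarser [c] in the middle: (c, b) and (a, c, b) have the same kernels as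
    b and (a, b). *)
Lemma conditional_entropy_le (I J K : finType) (a : X -> I) (b : X -> J)
    (c : X -> K) :
  measurable_partition a -> measurable_partition b -> measurable_partition c ->
  (forall x y, b x = b y -> c x = c y) ->
  conditional_entropy a b <= conditional_entropy a c.
Proof.
move=> ma mb mc bc; rewrite /conditional_entropy.
have := partition_entropy_submodular mu ma mc mb.
have mac := measurable_partition_pair ma mc.
rewrite (_ : partition_entropy mu (fun x => (c x, b x)) = partition_entropy mu b); last first.
  apply: partition_entropy_eq => //; first exact: measurable_partition_pair.
  by move=> x y; split => [bxy|[]//]; rewrite (bc _ _ bxy) bxy.
rewrite (_ : partition_entropy mu (fun x => (a x, c x, b x)) =
             partition_entropy mu (fun x => (a x, b x))); last first.
  apply: partition_entropy_eq => //; try by do ?exact: measurable_partition_pair.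
  by move=> x y; split => [[axy bxy]|[-> _ ->]//]; rewrite axy (bc _ _ bxy) bxy.
lra.
Qed.

(* AM-GM applied to [t ln (1 / t) <= 2 sqrt t (1 - t)] *)
Lemma mulrNln_le (t e : R) : 0 < t -> t <= 1 -> 0 < e ->
  t * - ln t <= e + t * (1 - t) / e.
Proof.
move=> t0 t1 e0; set s := Num.sqrt t.
have s0 : 0 < s by rewrite sqrtr_gt0.
have tE : t = s ^+ 2 by rewrite sqr_sqrtr// ltW.
have s1 : s <= 1 by rewrite -(sqrtr1 R) ler_wsqrtr.
have h1 : t * - ln t <= 2 * s * (1 - s).
  have := ln_ge1BV s0; rewrite tE lnXn// => h.
  have -> : 2 * s * (1 - s) = s ^+ 2 * - ((1 - s^-1) *+ 2).
    by rewrite mulr2n; field; exact: lt0r_neq0.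
  by rewrite ler_pM2l ?exprn_gt0// lerN2 lerMn2r.
apply: (le_trans h1).
have h2 : 0 <= (e - s * (1 - t)) ^+ 2 / e by rewrite divr_ge0 ?sqr_ge0// ltW.
have -> : e + t * (1 - t) / e = (e - s * (1 - t)) ^+ 2 / e + 2 * s * (1 - t)
   + t * (1 - t) * t / e.
  rewrite tE; field; exact: lt0r_neq0.
have h3 : 0 <= t * (1 - t) * t / e.
  by rewrite divr_ge0 ?(ltW e0)// !mulr_ge0 ?subr_ge0// ltW.
have h4 : 2 * s * (1 - s) <= 2 * s * (1 - t).
  by rewrite ler_wpM2l ?mulr_ge0 ?(ltW s0)// lerD2l lerN2 tE expr2 ler_piMl// ltW.
lra.
Qed.

(** If each event [a = i] is close to the event that [b] lies in [C i], then [b] nearly determines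
    [a]. [mulrNln_le] is applied to the conditional probability t of i given j; from t (1 - t) the
    factor 1 - t is kept when j is in [C i] and t otherwise, so the sum measures symmetric
    differences. *)
Lemma conditional_entropy_approx (I J : finType) (a : X -> I) (b : X -> J)
    (C : I -> pred J) (e : R) : 0 < e ->
  measurable_partition a -> measurable_partition b ->
  conditional_entropy a b <= #|I|%:R * e +
    e^-1 * \sum_i (fine (mu (a @^-1` [set i] `\` b @^-1` [set` C i])) +
                   fine (mu (b @^-1` [set` C i] `\` a @^-1` [set i]))).
Proof.
move=> e0 ma mb; have mab := measurable_partition_pair ma mb.
rewrite /conditional_entropy (_ : b = snd \o (fun x => (a x, b x)))//.
rewrite [partition_entropy mu (fun _ => _)](_ : _ = partition_entropy mu (id \o (fun x => (a x, b x))))//.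
rewrite !partition_entropy_factor// opprK addrC -sumrB.
set ab := fun x => (a x, b x).
have -> : snd \o ab = b by [].
pose p := weight mu ab; pose r := weight mu b.
have pr i j : p (i, j) <= r j by exact: (weight_le_factor mu snd (i, j) mab).
have p0 i j : 0 <= p (i, j) by exact: weight_ge0.
have r0 j : 0 <= r j by exact: weight_ge0.
apply: (@le_trans _ _ (\sum_i \sum_j (e * r j + e^-1 * (if C i j then r j - p (i, j) else p (i, j))))).
  rewrite pair_bigA/=; apply: ler_sum => -[i j] _; rewrite -/(p _) -/(r _) /=.
  have [->|pij0] := eqVneq (p (i, j)) 0.
    rewrite !mul0r subr0 addr_ge0 ?mulr_ge0 ?invr_ge0 ?(ltW e0)//.
    by case: ifP => //; rewrite subr0.
  have p_gt0 : 0 < p (i, j) by rewrite lt0r pij0 p0.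
  have r_gt0 : 0 < r j := lt_le_trans p_gt0 (pr i j).
  have t0 : 0 < p (i, j) / r j by exact: divr_gt0.
  have t1 : p (i, j) / r j <= 1 by rewrite ler_pdivrMr// mul1r.
  rewrite -mulrBr -opprB -ln_div ?posrE//.
  have h := mulrNln_le t0 t1 e0.
  have -> : p (i, j) * - ln (p (i, j) / r j) = r j * (p (i, j) / r j * - ln (p (i, j) / r j)).
    by field; exact: lt0r_neq0.
  apply: (@le_trans _ _ (r j * (e + p (i, j) / r j * (1 - p (i, j) / r j) / e))).
    by rewrite ler_pM2l.
  have -> : r j * (e + p (i, j) / r j * (1 - p (i, j) / r j) / e) =
    e * r j + e^-1 * (p (i, j) * (1 - p (i, j) / r j)).
    by field; rewrite !lt0r_neq0.
  rewrite lerD2l ler_pM2l ?invr_gt0//; case: ifP => _; last first.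
    by rewrite ler_piMr// lerBlDr lerDl ltW.
  have -> : p (i, j) * (1 - p (i, j) / r j) = (p (i, j) / r j) * (r j - p (i, j)).
    by field; exact: lt0r_neq0.
  by rewrite ler_piMl// subr_ge0.
under eq_bigr do rewrite big_split/= -!mulr_sumr (sum_weight mu mb) mulr1.
rewrite big_split/= sumr_const -[e *+ _]mulr_natl lerD2l -mulr_sumr.
rewrite ler_pM2l ?invr_gt0//; apply: ler_sum => i _.
rewrite (bigID (C i))/= addrC lerD//.
  rewrite setDE preimage_setC (_ : ~` _ = [set j | ~~ C i j]); last first.
    by apply/seteqP; split => j /= /negP.
  rewrite (fine_probability_label mu (fun j => ~~ C i j) mb)//; apply: ler_sum => j /negbTE ->.
  apply: fine_probability_le => //; first exact: measurableI.
  by move=> x /= [-> ->].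
rewrite setDE setIC (fine_probability_label mu (C i) mb)//; last exact: measurableC.
apply: ler_sum => j ->.
rewrite lerBlDr [leRHS](_ : _ = r j)//.
rewrite /p /r /weight -fine_probabilityU//.
- congr (fine (mu _)); apply/seteqP; split => x /=.
    by move=> [[_ bx]//|[_ bx]].
  move=> <-; have [ax|ax] := eqVneq (a x) i; first by right; rewrite -ax.
  by left; split => //; apply/eqP.
- by apply: measurableI => //; exact: measurableC.
- by apply/seteqP; split => // x /= [[ai _] [? _]].
Qed.

End conditional_entropy.

(** * Entropy of a partition as a limit of conditional entropies *)

Section dynamical_entropy.
Context {dsp : measure_display} {X : measurableType dsp} {R : realType}.
Variables (mu : probability X R) (T : X -> X).
Hypothesis mT : forall U, measurable U -> measurable (T @^-1` U).
Hypothesis muT : forall U, measurable U -> mu (T @^-1` U) = mu U.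

Local Notation H := (partition_entropy mu).
Local Notation cH := (conditional_entropy mu).

Lemma partition_join_eqP (I : finType) (xi : X -> I) n x y :
  partition_join T xi n x = partition_join T xi n y <->
  forall j, (j < n)%N -> xi (iter j T x) = xi (iter j T y).
Proof.
split => [/ffunP xy j jn|xy]; first by have := xy (Ordinal jn); rewrite !ffunE.
by apply/ffunP => j; rewrite !ffunE xy.
Qed.

Lemma partition_joinS_eqP (I : finType) (xi : X -> I) n x y :
  (xi x, partition_join T xi n (T x)) = (xi y, partition_join T xi n (T y)) <->
  partition_join T xi n.+1 x = partition_join T xi n.+1 y.
Proof.
rewrite partition_join_eqP; split => [[xy /partition_join_eqP xyn] [//|j jn]|xy].
  by rewrite !iterSr xyn.
congr pair; first exact: (xy 0%N).
by apply/partition_join_eqP => j jn; rewrite -!iterSr xy.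
Qed.

Lemma measurable_partition_map (I : finType) (xi : X -> I) :
  measurable_partition xi -> measurable_partition (xi \o T).
Proof. by move=> mxi i; rewrite comp_preimage; exact: mT. Qed.

Lemma measurable_partition_join (I : finType) (xi : X -> I) n :
  measurable_partition xi -> measurable_partition (partition_join T xi n).
Proof.
move=> mxi; elim: n => [|n IHn].
  apply: (@measurable_partition_le _ _ _ _ (fun=> tt) _ _) => [i|x y _].
    by rewrite preimage_cst; case: ifP.
  by apply/partition_join_eqP.
apply: (measurable_partition_le (measurable_partition_pair mxi
  (measurable_partition_map IHn))).
by move=> x y; apply (partition_joinS_eqP xi n x y).1.
Qed.

Lemma partition_entropy_map (I : finType) (xi : X -> I) :
  measurable_partition xi -> H (xi \o T) = H xi.
Proof.
move=> mxi; rewrite /partition_entropy; congr (- _); apply: eq_bigr => i _.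
by rewrite comp_preimage muT.
Qed.

Lemma partition_entropy_join0 (I : finType) (xi : X -> I) :
  measurable_partition xi -> H (partition_join T xi 0) = 0.
Proof.
move=> mxi; have mtt : measurable_partition (fun _ : X => tt).
  by move=> i; rewrite preimage_cst; case: ifP.
rewrite (@partition_entropy_eq _ _ _ mu _ _ (fun=> tt))//.
- rewrite /partition_entropy (big_pred1 tt); last by case.
  rewrite preimage_cst ifT ?inE ?probability_setT ?ln1 ?mulr0 ?oppr0//.
- exact: measurable_partition_join.
- by move=> x y; split => // _; apply/partition_join_eqP.
Qed.

(** By invariance the joins over times 1, ..., n and 0, ..., n - 1 have equal entropy, so an
    increment is the entropy of the present given n future steps. *)
Lemma partition_entropy_joinS (I : finType) (xi : X -> I) n :
  measurable_partition xi ->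
  H (partition_join T xi n.+1) - H (partition_join T xi n) =
  cH xi (partition_join T xi n \o T).
Proof.
move=> mxi; have mj n' : measurable_partition (partition_join T xi n') by exact: measurable_partition_join.
rewrite /conditional_entropy partition_entropy_map//; congr (_ - _).
apply: partition_entropy_eq => //.
  exact: measurable_partition_pair (measurable_partition_map _).
by move=> x y; exact: partition_joinS_eqP.
Qed.

Definition entropy_increment (I : finType) (xi : X -> I) n : R :=
  H (partition_join T xi n.+1) - H (partition_join T xi n).

Lemma entropy_increment_ge0 (I : finType) (xi : X -> I) n :
  measurable_partition xi -> 0 <= entropy_increment xi n.
Proof.
move=> mxi; rewrite /entropy_increment partition_entropy_joinS//.
by apply: conditional_entropy_ge0 => //; exact/measurable_partition_map/measurable_partition_join.
Qed.

Lemma entropy_increment_nonincreasing (I : finType) (xi : X -> I) :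
  measurable_partition xi -> nonincreasing_seq (entropy_increment xi).
Proof.
move=> mxi; apply/nonincreasing_seqP => n.
rewrite /entropy_increment !partition_entropy_joinS//.
have mj n' : measurable_partition (partition_join T xi n' \o T).
  exact/measurable_partition_map/measurable_partition_join.
apply: conditional_entropy_le => // x y /partition_join_eqP xy.
by apply/partition_join_eqP => j jn; apply: xy; rewrite ltnS ltnW.
Qed.

Lemma entropy_increment_cvg (I : finType) (xi : X -> I) :
  measurable_partition xi -> cvgn (entropy_increment xi).
Proof.
move=> mxi; apply: nonincreasing_is_cvgn.
  exact: entropy_increment_nonincreasing.
by exists 0 => _ [n _ <-]; exact: entropy_increment_ge0.
Qed.

Lemma entropy_of_partition_cvg (I : finType) (xi : X -> I) :
  measurable_partition xi ->
  H (partition_join T xi n) / n%:R @[n --> \oo] --> limn (entropy_increment xi).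
Proof.
move=> mxi; rewrite -cvg_shiftS/=.
(* The increments telescope: the quotient is their arithmetic mean, and Cesaro's theorem applies. *)
rewrite (_ : (fun n => _) = arithmetic_mean (entropy_increment xi)); last first.
  apply/funext => n; rewrite /arithmetic_mean/= seriesEnat/= /entropy_increment.
  by rewrite telescope_sumr// partition_entropy_join0// subr0 mulrC.
exact/cesaro/entropy_increment_cvg.
Qed.

Lemma entropy_of_partitionE (I : finType) (xi : X -> I) :
  measurable_partition xi ->
  entropy_of_partition mu T xi = limn (entropy_increment xi).
Proof. by move=> mxi; apply/cvg_lim => //; exact: entropy_of_partition_cvg. Qed.

Lemma entropy_of_partition_le_increment (I : finType) (xi : X -> I) n :
  measurable_partition xi -> entropy_of_partition mu T xi <= entropy_increment xi n.
Proof.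
move=> mxi; rewrite entropy_of_partitionE//.
apply: nonincreasing_cvgn_ge; first exact: entropy_increment_nonincreasing.
exact: entropy_increment_cvg.
Qed.

(** The chain rule splits off the label [eta] at time 0. Conditioning on less increases both terms,
    and invariance turns the second into the case n. *)
Lemma partition_entropy_join_pair (I J : finType) (eta : X -> I) (alpha : X -> J) n :
  measurable_partition eta -> measurable_partition alpha ->
  cH (partition_join T eta n) (partition_join T alpha n) <= n%:R * cH eta alpha.
Proof.
move=> me ma; have mje k : measurable_partition (partition_join T eta k) by exact: measurable_partition_join.
have mja k : measurable_partition (partition_join T alpha k) by exact: measurable_partition_join.
elim: n => [|n IHn].
  rewrite mul0r subr_le0 partition_entropy_le// => x y _.
  by congr pair; apply/partition_join_eqP.
pose E := partition_join T eta n \o T; pose A := partition_join T alpha n \o T.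
have mE : measurable_partition E by exact: measurable_partition_map.
have mA : measurable_partition A by exact: measurable_partition_map.
have maA := measurable_partition_pair ma mA.
have mEaA := measurable_partition_pair mE maA.
have -> : cH (partition_join T eta n.+1) (partition_join T alpha n.+1) =
    cH eta (fun x => (E x, (alpha x, A x))) + cH E (fun x => (alpha x, A x)).
  rewrite /conditional_entropy addrA subrK; congr (_ - _).
    apply: partition_entropy_eq.
    - exact: measurable_partition_pair me mEaA.
    - exact: measurable_partition_pair.
    move=> x y; split => [[exy Exy axy Axy]|].
      by congr pair; apply/partition_joinS_eqP; congr pair.
    by move=> [/partition_joinS_eqP[exy Exy] /partition_joinS_eqP[axy Axy]]; rewrite /E /A/= exy Exy axy Axy.
  by apply: partition_entropy_eq => // x y; exact: partition_joinS_eqP.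
have h1 : cH eta (fun x => (E x, (alpha x, A x))) <= cH eta alpha.
  by apply: conditional_entropy_le => // x y [].
have h2 : cH E (fun x => (alpha x, A x)) <= cH E A.
  by apply: conditional_entropy_le => // x y [].
have h3 : cH E A = cH (partition_join T eta n) (partition_join T alpha n).
  rewrite /conditional_entropy (partition_entropy_map (mja n)).
  by rewrite -(partition_entropy_map (measurable_partition_pair (mje n) (mja n))).
rewrite -natr1 mulrDl mul1r addrC lerD//.
by rewrite (le_trans h2)// h3.
Qed.

Lemma partition_entropy_joinD (I : finType) (xi : X -> I) n m :
  measurable_partition xi ->
  H (partition_join T xi (n + m)) <=
  H (partition_join T xi n) + m%:R * entropy_increment xi 0.
Proof.
move=> mxi; elim: m => [|m IHm]; first by rewrite addn0 mul0r addr0.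
rewrite addnS -natr1 mulrDl mul1r addrA.
have := entropy_increment_nonincreasing mxi (leq0n (n + m)).
rewrite {1}/entropy_increment lerBlDr => h; apply: (le_trans h).
by rewrite addrC lerD.
Qed.

(* Compare the joins of [eta] with those of the block partition [alpha], the join
   of [m] translates of [xi]: [H (eta^n) <= H (alpha^n) + n H (eta | alpha)]. *)
Lemma entropy_of_partition_le (I J : finType) (eta : X -> I) (xi : X -> J) m :
  measurable_partition eta -> measurable_partition xi ->
  entropy_of_partition mu T eta <=
  entropy_of_partition mu T xi + cH eta (partition_join T xi m).
Proof.
move=> meta mxi; pose c := cH eta (partition_join T xi m).
have mj : measurable_partition (partition_join T xi m) by exact: measurable_partition_join.
have bnd n : H (partition_join T eta n) / n%:R <=
    H (partition_join T xi n) / n%:R + (m%:R * entropy_increment xi 0) * n%:R^-1 + c.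
  (* Division by 0 gives 0, so at n = 0 the bound reads [0 <= c]. *)
  case: n => [|n]; first by rewrite invr0 !mulr0 !add0r conditional_entropy_ge0.
  have n0 : 0 < n.+1%:R :> R by rewrite ltr0n.
  rewrite -(mulfK (lt0r_neq0 n0) c) -!mulrDl ler_pM2r ?invr_gt0//.
  have h1 : H (partition_join T eta n.+1) <= H (fun x => (partition_join T eta n.+1 x,
      partition_join T (partition_join T xi m) n.+1 x)).
    apply: partition_entropy_le; last by move=> x y [].
    by apply: measurable_partition_pair; exact: measurable_partition_join.
  have h2 := partition_entropy_join_pair n.+1 meta mj.
  (* The [n.+1] overlapping blocks of length [m] only read times below n + m. *)
  have h3 : H (partition_join T (partition_join T xi m) n.+1) <= H (partition_join T xi (n.+1 + m)).
    apply: partition_entropy_le; first exact: measurable_partition_join.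
    move=> x y /partition_join_eqP xy; apply/partition_join_eqP => j jn.
    apply/partition_join_eqP => i im; rewrite -!iterD; apply: xy.
    by rewrite addnC -addSn leq_add// ltnW.
  have h4 := partition_entropy_joinD n.+1 m mxi.
  rewrite /conditional_entropy in h2; rewrite mulrC /c /conditional_entropy; lra.
rewrite !entropy_of_partitionE//.
have cvgr : (fun n => H (partition_join T xi n) / n%:R +
    (m%:R * entropy_increment xi 0) * n%:R^-1 + c) @ \oo -->
    limn (entropy_increment xi) + (m%:R * entropy_increment xi 0) * 0 + c.
  apply: cvgD; last exact: cvg_cst.
  apply: cvgD; first exact: (entropy_of_partition_cvg mxi).
  apply: cvgM; first exact: cvg_cst.
  by rewrite -(cvg_shiftS (fun n => n%:R^-1 : R)); exact: cvg_harmonic.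
rewrite -/c -[X in X + c]addr0 -(mulr0 (m%:R * entropy_increment xi 0)).
exact: (ler_cvg_to (entropy_of_partition_cvg meta) cvgr (nearW _ bnd)).
Qed.

End dynamical_entropy.

(** * The full shift *)

Section cylinders.
Context {R : realType} {d : nat}.
Local Notation Omega := (shift_space R d).
Implicit Types (x y z : Omega) (U : set Omega).

Definition agree n x y := forall i, (i < n)%N -> x i = y i.

Lemma agree_sym n x y : agree n x y -> agree n y x.
Proof. by move=> xy i /xy. Qed.

Lemma agree_trans n y x z : agree n x y -> agree n y z -> agree n x z.
Proof. by move=> xy yz i ni; rewrite xy// yz. Qed.

Lemma agree_le n m x y : (n <= m)%N -> agree m x y -> agree n x y.
Proof. by move=> nm xy i ni; apply: xy; exact: leq_trans nm. Qed.

Lemma agree_mdist n x y : agree n x y -> mdist x y <= 2 ^- n.+1.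
Proof.
move=> xy; rewrite /mdist/= /shift_dist; case: pselect => [xy'|_]; last first.
  by rewrite invr_ge0 exprn_ge0.
case: ex_minnP => m xym _; rewrite lef_pV2 ?posrE ?exprn_gt0//.
rewrite ler_eXn2l ?ltr1n// ltnS leqNgt; apply/negP => mn.
by move: xym; rewrite xy ?eqxx.
Qed.

Definition letter x : 'I_d.+1 := x 0%N.

Definition word n : Omega -> {ffun 'I_n -> 'I_d.+1} :=
  partition_join shift_map letter n.

Lemma iter_shift_map j x i : iter j shift_map x i = x (j + i)%N.
Proof. by elim: j i => //= j IHj i; rewrite /shift_map IHj addSnnS. Qed.

Lemma wordE n x (j : 'I_n) : word n x j = x j.
Proof. by rewrite ffunE /letter iter_shift_map addn0. Qed.

Lemma wordP n x y : word n x = word n y <-> agree n x y.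
Proof.
split => [/ffunP xy i ni|xy]; first by have := xy (Ordinal ni); rewrite !wordE.
by apply/ffunP => j; rewrite !wordE xy.
Qed.

Definition depends_on n U := forall x y, agree n x y -> U x -> U y.

Lemma depends_onE n U : depends_on n U -> U = word n @^-1` (word n @` U).
Proof.
move=> nU; apply/seteqP; split => [x Ux|x [y Uy /wordP yx]]; first by exists x.
exact: nU Uy.
Qed.

Lemma depends_on_le n m U : (n <= m)%N -> depends_on n U -> depends_on m U.
Proof. by move=> nm nU x y /(agree_le nm); exact: nU. Qed.

Lemma depends_on_word n (P : set {ffun 'I_n -> 'I_d.+1}) :
  depends_on n (word n @^-1` P).
Proof. by move=> x y /wordP /= ->. Qed.

Lemma open_depends_on n U : depends_on n U -> open U.
Proof.
move=> nU; rewrite openE => x Ux; apply/nbhs_ballP.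
exists (2 ^- n); first by rewrite /= invr_gt0 exprn_gt0.
by move=> y; rewrite ballEmdist/= => /shift_dist_lt_agree /nU; exact.
Qed.

Lemma measurable_depends_on n U : depends_on n U -> measurable U.
Proof. by move=> /open_depends_on; exact: sub_sigma_algebra. Qed.

(** The union is countable and its members depend on finitely many coordinates, which is why such
    sets generate the Borel sigma-algebra. *)
Lemma open_bigcup_depends_on U : open U ->
  U = \bigcup_n [set x | forall y, agree n x y -> U y].
Proof.
rewrite openE => oU; apply/seteqP; split => [x /oU /nbhs_ballP[e /= e0 xeU]|x [n _]]; last exact.
have [n ne] : exists n, 2 ^- n.+1 < e.
  have /cvgrPdist_lt /(_ _ e0)[n _ /(_ n (leqnn _))] := @cvg_geometric R 1 (2^-1) (ltac:(by rewrite ger0_norm ?invf_lt1 ?ltr1n)).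
  rewrite /geometric/= mul1r sub0r normrN ger0_norm ?exprn_ge0 ?invr_ge0// exprVn => h.
  exists n; apply: le_lt_trans h.
  by rewrite lef_pV2 ?posrE ?exprn_gt0// ler_eXn2l ?ltr1n.
exists n => //= y /agree_mdist xy; apply: xeU.
by rewrite ballEmdist/=; exact: le_lt_trans ne.
Qed.

Definition clopen_sets : set (set Omega) := [set U | exists n, depends_on n U].

Lemma measurable_clopen_sets : @measurable _ Omega = <<s clopen_sets >>.
Proof.
apply/seteqP; split.
  apply: smallest_sub; first exact: smallest_sigma_algebra.
  move=> U /open_bigcup_depends_on ->; apply: sigma_algebra_bigcup => n.
  apply: sub_sigma_algebra; exists n => x y xy /= xU z yz; apply: xU.
  exact: agree_trans yz.
apply: smallest_sub; first exact: sigma_algebra_measurable.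
by move=> U [n]; exact: measurable_depends_on.
Qed.

Lemma setI_closed_clopen_sets : setI_closed clopen_sets.
Proof.
move=> U V [n nU] [m mV]; exists (maxn n m) => x y xy [Ux Vx]; split.
  by apply: nU Ux; apply: agree_le xy; exact: leq_maxl.
by apply: mV Vx; apply: agree_le xy; exact: leq_maxr.
Qed.

Lemma measurable_partition_letter : measurable_partition letter.
Proof.
move=> i; apply: (@measurable_depends_on 1) => x y xy /=.
by rewrite /letter xy.
Qed.

Lemma measurable_partition_word n : measurable_partition (word n).
Proof. by move=> w; apply: (@measurable_depends_on n); exact: depends_on_word. Qed.

Lemma measurable_shift_map U : measurable U -> measurable (shift_map @^-1` U).
Proof.
rewrite [X in X U -> _]measurable_clopen_sets; move: U.
apply: smallest_sub; first split.
- by rewrite /= preimage_set0.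
- by move=> U mU /=; rewrite setTD -preimage_setC; exact: measurableC.
- by move=> U mU /=; rewrite preimage_bigcup; exact: bigcup_measurable.
move=> U [n nU]; apply: (@measurable_depends_on n.+1) => x y xy; apply: nU => i ni.
exact: xy.
Qed.

(** Sets depending on finitely many coordinates form a generating pi-system, and each is a finite
    disjoint union of word cylinders. *)
Lemma probability_word_unique (mu nu : probability Omega R) :
  (forall n w, mu (word n @^-1` [set w]) = nu (word n @^-1` [set w])) ->
  forall U, measurable U -> mu U = nu U.
Proof.
move=> munu; apply: (measure_unique clopen_sets (fun=> setT)) => //.
- exact: measurable_clopen_sets.
- exact: setI_closed_clopen_sets.
- by move=> _; exists 0%N.
- by rewrite bigcup_const.
- move=> U [n nU]; rewrite (depends_onE nU); set P := _ @` U.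
  have mP (m : probability Omega R) : m (word n @^-1` P) =
      (\sum_(w | w \in P) fine (m (word n @^-1` [set w])))%:E.
    have mw : measurable_partition (word n : Omega -> _) by exact: measurable_partition_word.
    have := fine_probability_label m (fun w => w \in P) mw measurableT.
    rewrite setTI (_ : [set i | i \in P] = P); last by apply/seteqP; split => w /=; rewrite inE.
    under eq_bigr do rewrite setTI.
    move=> <-; rewrite fineK// fin_num_measure//.
    exact: preimage_label_measurable mw.
  apply: (etrans (mP mu)); apply: (etrans _ (esym (mP nu))).
  by congr (_%:E); apply: eq_bigr => w _; rewrite munu.
- by move=> _; rewrite (le_lt_trans (probability_le1 _ _)) ?ltry.
Qed.

End cylinders.

(** * Approximation of Borel sets by clopen sets *)

Section approximation.
Context {R : realType} {d : nat}.
Local Notation Omega := (shift_space R d).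
Variable mu : probability Omega R.

Lemma fine_probabilityU_le (U V : set Omega) : measurable U -> measurable V ->
  fine (mu (U `|` V)) <= fine (mu U) + fine (mu V).
Proof.
move=> mU mV; rewrite -fineD ?fin_num_measure//.
apply: fine_le; rewrite ?fin_numD ?fin_num_measure//; first exact: measurableU.
exact: measureU2.
Qed.

Definition approximable (U : set Omega) := measurable U /\
  forall e : R, 0 < e -> exists n C, depends_on n C /\
    fine (mu (U `\` C)) + fine (mu (C `\` U)) <= e.

Lemma approximableC U : approximable U -> approximable (~` U).
Proof.
move=> [mU aU]; split; first exact: measurableC.
move=> e /aU[n [C [nC UC]]]; exists n, (~` C); split.
  by move=> x y xy Cx Cy; apply: Cx; apply: nC Cy; exact: agree_sym.
by rewrite !setDE !setCK addrC [~` U `&` C]setIC [~` C `&` U]setIC -!setDE.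
Qed.

Lemma approximableU U V : approximable U -> approximable V -> approximable (U `|` V).
Proof.
move=> [mU aU] [mV aV]; split; first exact: measurableU.
move=> e e0; have e2 : 0 < e / 2 by rewrite divr_gt0.
have [n [C [nC UC]]] := aU _ e2; have [m [D [mD VD]]] := aV _ e2.
have mC := measurable_depends_on nC; have mDD := measurable_depends_on mD.
exists (maxn n m), (C `|` D); split.
  move=> x y xy [Cx|Dx]; [left|right].
    by apply: nC Cx; apply: agree_le xy; exact: leq_maxl.
  by apply: mD Dx; apply: agree_le xy; exact: leq_maxr.
have h1 : fine (mu ((U `|` V) `\` (C `|` D))) <= fine (mu (U `\` C)) + fine (mu (V `\` D)).
  apply: (le_trans _ (fine_probabilityU_le _ _)); try exact: measurableD.
  apply: fine_probability_le; [apply: measurableD; exact: measurableU|apply: measurableU; exact: measurableD|].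
  by move=> x [[Ux|Vx] /not_orP[Cx Dx]]; [left|right].
have h2 : fine (mu ((C `|` D) `\` (U `|` V))) <= fine (mu (C `\` U)) + fine (mu (D `\` V)).
  apply: (le_trans _ (fine_probabilityU_le _ _)); try exact: measurableD.
  apply: fine_probability_le; [apply: measurableD; exact: measurableU|apply: measurableU; exact: measurableD|].
  by move=> x [[Ux|Vx] /not_orP[Cx Dx]]; [left|right].
by rewrite (splitr e); lra.
Qed.

Lemma approximable_depends_on n U : depends_on n U -> approximable U.
Proof.
move=> nU; split; first exact: measurable_depends_on nU.
by move=> e e0; exists n, U; split => //; rewrite setDv measure0 addr0 ltW.
Qed.

(** By continuity from below a finite union misses at most e / 2 of the measure; that finite union
    is itself approximated up to e / 2. *)
Lemma approximable_bigcup (U : (set Omega)^nat) :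
  (forall k, approximable (U k)) -> approximable (\bigcup_k U k).
Proof.
move=> aU; have mU k : measurable (U k) by case: (aU k).
have mUU : measurable (\bigcup_k U k) by exact: bigcup_measurable.
split => // e e0; have e2 : 0 < e / 2 by rewrite divr_gt0.
pose V n := \bigcup_(k < n) U k.
have mV n : measurable (V n) by exact: bigcup_measurable.
have aV n : approximable (V n).
  elim: n => [|n IHn]; last by rewrite /V bigcup_mkord big_ord_recr/= -bigcup_mkord; exact: approximableU.
  by rewrite /V bigcup_mkord big_ord0; apply: (@approximable_depends_on 0).
have VU : \bigcup_n V n = \bigcup_k U k.
  apply/seteqP; split => [x [n _ [k _ Uk]]|x [k _ Uk]]; first by exists k.
  by exists k.+1 => //; exists k => /=.
have : mu \o V @ \oo --> mu (\bigcup_n V n).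
  apply: nondecreasing_cvg_mu => //; first by rewrite VU.
  by move=> n m nm; apply/subsetPset => x [k /= kn Uk]; exists k => //=; exact: leq_trans nm.
rewrite VU -[mu (\bigcup_k U k)]fineK ?fin_num_measure// => /fine_cvgP[_ /cvgrPdist_lt /(_ _ e2)[n _ /(_ n (leqnn n))]] /=.
have VnU : V n `<=` \bigcup_k U k by rewrite -VU; exact: bigcup_sup.
have UVn : fine (mu (\bigcup_k U k)) = fine (mu (V n)) + fine (mu (\bigcup_k U k `\` V n)).
  rewrite -fine_probabilityU//; [|exact: measurableD|by rewrite setDIK].
  by rewrite setDUK.
rewrite UVn addrC addKr => /(le_lt_trans (ler_norm _)) h.
have [m [C [mC VC]]] := (aV n).2 _ e2.
have mCm := measurable_depends_on mC.
exists m, C; split => //.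
have h1 : fine (mu (\bigcup_k U k `\` C)) <= fine (mu (\bigcup_k U k `\` V n)) + fine (mu (V n `\` C)).
  apply: (le_trans _ (fine_probabilityU_le _ _)); try exact: measurableD.
  apply: fine_probability_le; [exact: measurableD|apply: measurableU; exact: measurableD|].
  by move=> x [Ux Cx]; have [Vx|Vx] := pselect (V n x); [right|left].
have h2 : fine (mu (C `\` \bigcup_k U k)) <= fine (mu (C `\` V n)).
  apply: fine_probability_le; [exact: measurableD|exact: measurableD|].
  by move=> x [Cx Ux]; split => // /VnU.
by rewrite (splitr e); lra.
Qed.

Lemma measurable_approximable U : measurable U -> approximable U.
Proof.
rewrite [X in X U -> _]measurable_clopen_sets; move: U.
apply: smallest_sub; first split.
- by apply: (@approximable_depends_on 0).
- by move=> U aU; rewrite setTD; exact: approximableC.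
- exact: approximable_bigcup.
by move=> U [n]; exact: approximable_depends_on.
Qed.

End approximation.

(** * The letter partition computes the entropy *)

Section ks_entropy_shift.
Context {R : realType} {d : nat}.
Local Notation Omega := (shift_space R d).
Variable rho : probability Omega R.
Hypothesis rhoT : shift_invariant rho.

Lemma conditional_entropy_word_small k (eta : Omega -> 'I_k) (e : R) :
  measurable_partition eta -> 0 < e ->
  exists m, conditional_entropy rho eta (word m) <= e.
Proof.
(* With an error of at most [s * s] per cell, both terms of [conditional_entropy_approx] are at most
   [k%:R * s], and 2 k s <= e. *)
move=> meta e0; pose s := e / (2 * k.+1%:R).
have k0 : 0 < k.+1%:R :> R by rewrite ltr0n.
have s0 : 0 < s by rewrite divr_gt0// mulr_gt0.
pose dl := s * s; have dl0 : 0 < dl by exact: mulr_gt0.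
have /choice[f hf] : forall i, exists nC : nat * set Omega, depends_on nC.1 nC.2 /\
    fine (rho (eta @^-1` [set i] `\` nC.2)) + fine (rho (nC.2 `\` eta @^-1` [set i])) <= dl.
  move=> i; have [_ /(_ _ dl0)[n [C hC]]] := measurable_approximable rho (meta i).
  by exists (n, C).
pose m := (\max_i (f i).1)%N; exists m.
pose D i w := `[< (word m @` (f i).2) w >].
have DE i : word m @^-1` [set` D i] = (f i).2.
  rewrite [RHS](@depends_onE _ _ m).
    by congr (_ @^-1` _); apply/seteqP; split => w /asboolP.
  by apply: depends_on_le (hf i).1; exact: leq_bigmax.
have mw : measurable_partition (word m : Omega -> _) by exact: measurable_partition_word.
apply: (le_trans (conditional_entropy_approx rho D s0 meta mw)).
rewrite card_ord.
have h1 : \sum_i (fine (rho (eta @^-1` [set i] `\` word m @^-1` [set` D i])) +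
     fine (rho (word m @^-1` [set` D i] `\` eta @^-1` [set i]))) <= k%:R * dl.
  rewrite -[k in k%:R]card_ord mulr_natl -sumr_const; apply: ler_sum => i _.
  by rewrite DE (hf i).2.
have h2 : s^-1 * (k%:R * dl) = k%:R * s by rewrite /dl; field; exact: lt0r_neq0.
apply: (@le_trans _ _ (k%:R * s + k%:R * s)).
  by rewrite lerD2l -h2 ler_pM2l ?invr_gt0.
have -> : e = k.+1%:R * s + k.+1%:R * s by rewrite /s; field; rewrite ?(lt0r_neq0 k0)//.
by rewrite -natr1 mulrDl mul1r; lra.
Qed.

Lemma ks_entropy_shift :
  ks_entropy rho shift_map = (entropy_of_partition rho shift_map letter)%:E.
Proof.
have mT := @measurable_shift_map R d.
have ml : measurable_partition (letter : Omega -> _) by exact: measurable_partition_letter.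
apply/eqP; rewrite eq_le; apply/andP; split; last first.
  by apply: ereal_sup_ubound; exists d.+1, letter.
apply: ge_ereal_sup => _ [k [eta [meta ->]]]; rewrite lee_fin.
apply/ler_addgt0Pr => e e0.
have [m hm] := conditional_entropy_word_small meta e0.
apply: (le_trans (entropy_of_partition_le mT rhoT m meta ml)).
by rewrite lerD2l.
Qed.

End ks_entropy_shift.

(** * The Ruelle operator *)

(** A cluster point exists by compactness and is a limit along an ultrafilter. One ultrafilter
    serves all points of the shift space at once, so no subsequence is extracted. *)
Lemma ultralimit {R : realType} (U : set_system nat) (UU : UltraFilter U) (u : nat -> R) (c : R) :
  (forall n, `|u n| <= c) -> exists l : R, u @ U --> l.
Proof.
move=> uc; have UF := @ultra_proper _ _ UU.
have uU : (u @ U) `[- c, c]%classic.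
  by apply: nearW => n /=; rewrite in_itv/= -ler_norml.
have [l [_ ul]] := @segment_compact R (- c) c _ (fmap_proper_filter u UF) uU.
exists l => V lV; have [//|UVC] := in_ultra_setVsetC (u @^-1` V) UU.
by have [x [VCx /VCx]] := ul (~` V) V UVC lV.
Qed.

(** * Variation on cylinders and the log-sum-exp operator *)

Section variation.
Context {R : realType} {d : nat}.
Local Notation Omega := (shift_space R d).
Implicit Types (x y : Omega) (f : Omega -> R).

(** Hoelder regularity read on cylinders, with [th] = 2^(-alpha). The case n = 0 bounds the
    oscillation by [C]. *)
Definition has_variation (th C : R) f :=
  forall n x y, agree n x y -> `|f x - f y| <= C * th ^+ n.

Lemma hoelder_variation f : hoelder_potential f ->
  exists th C, [/\ 0 < th < 1, 0 <= C & has_variation th C f].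
Proof.
move=> [al [C [/andP[al0 al1] C0 fC]]].
exists (2^-1 `^ al), C; split => //.
  rewrite powR_gt0 ?invr_gt0//=; apply: (@lt_le_trans _ _ (1 `^ al)); last by rewrite powR1.
  by rewrite gt0_ltr_powR// ?nnegrE ?invr_ge0// invf_lt1// ltr1n.
move=> n x y xy; apply: (le_trans (fC x y)); rewrite ler_wpM2l//.
have -> : (2^-1 `^ al) ^+ n = ((2^-1) ^+ n) `^ al :> R.
  by rewrite -powR_mulrn ?powR_ge0// -powRrM mulrC powRrM powR_mulrn// invr_ge0.
rewrite ge0_ler_powR ?(ltW al0) ?nnegrE ?mdist_ge0 ?exprn_ge0 ?invr_ge0//.
apply: (le_trans (agree_mdist xy)).
by rewrite exprVn lef_pV2 ?posrE ?exprn_gt0// ler_eXn2l ?ltr1n.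
Qed.

Lemma variation_osc th C f x y : has_variation th C f -> `|f x - f y| <= C.
Proof. by move=> fC; have := @fC 0%N x y; rewrite expr0 mulr1; exact. Qed.

Lemma variation_bound th C f x : has_variation th C f ->
  `|f x| <= `|f point| + C.
Proof.
move=> fC; rewrite -(subrK (f point) (f x)) addrC.
by apply: (le_trans (ler_normD _ _)); rewrite lerD2l (variation_osc _ _ fC).
Qed.

Definition scons (a : 'I_d.+1) x : Omega := fun n => if n is m.+1 then x m else a.

Lemma agree_scons n a x y : agree n x y -> agree n.+1 (scons a x) (scons a y).
Proof. by move=> xy [//|i]; rewrite ltnS => /xy. Qed.

(** Applied to B + f, this is the logarithm of the Ruelle operator of B at exp f. It is monotone and
    commutes with adding constants, hence nonexpansive. *)
Definition logsumexp f x : R := ln (\sum_a expR (f (scons a x))).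

Lemma sum_expR_gt0 f x : 0 < \sum_a expR (f (scons a x)).
Proof.
rewrite (bigD1 ord0)//=; apply: ltr_wpDr; last exact: expR_gt0.
by apply: sumr_ge0 => a _; exact: expR_ge0.
Qed.

Lemma logsumexp_le f g x y c : (forall a, f (scons a x) <= g (scons a y) + c) ->
  logsumexp f x <= logsumexp g y + c.
Proof.
move=> fg; rewrite /logsumexp -[c in leRHS]expRK -lnM ?posrE ?expR_gt0 ?sum_expR_gt0//.
rewrite ler_ln ?posrE ?mulr_gt0 ?expR_gt0 ?sum_expR_gt0// mulr_suml.
by apply: ler_sum => a _; rewrite -expRD ler_expR.
Qed.

Lemma logsumexp_dist f g x y c :
  (forall a, `|f (scons a x) - g (scons a y)| <= c) ->
  `|logsumexp f x - logsumexp g y| <= c.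
Proof.
move=> fg; rewrite ler_distl lerBlDr; apply/andP; split; apply: logsumexp_le => a;
  by have := fg a; rewrite ler_distl lerBlDr => /andP[].
Qed.

Lemma logsumexpD f c x : logsumexp (fun z => f z + c) x = logsumexp f x + c.
Proof.
apply/eqP; rewrite eq_le logsumexp_le//=.
by rewrite -lerBrDr logsumexp_le// => a; rewrite addrK.
Qed.

End variation.

(** * The eigenfunction of the Ruelle operator *)

Section eigenfunction.
Context {R : realType} {d : nat}.
Local Notation Omega := (shift_space R d).
Variables (th K : R) (B : Omega -> R).
Hypotheses (th01 : 0 < th < 1) (BK : has_variation th K B).

(** The solution of [(K + D) * th = D]: prepending a letter gains a factor [th], so the variation
    bound [D] reproduces itself. *)
Let D := K * th / (1 - th).

Let th0 : 0 < th. Proof. by case/andP: th01. Qed.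
Let th1 : 0 < 1 - th. Proof. by rewrite subr_gt0; case/andP: th01. Qed.

Let K_ge0 : 0 <= K.
Proof. exact: le_trans (variation_osc point point BK). Qed.

Let D_ge0 : 0 <= D.
Proof. by rewrite divr_ge0 ?mulr_ge0// ltW. Qed.

Lemma variation_logsumexp q f : 0 <= q <= 1 -> has_variation th D f ->
  has_variation th D (logsumexp (fun z => B z + q * f z)).
Proof.
move=> /andP[q0 q1] fD n x y xy; apply: logsumexp_dist => a.
have axy := agree_scons a xy.
have h1 := BK axy; have h2 := fD _ _ _ axy.
have -> : D * th ^+ n = K * th ^+ n.+1 + D * th ^+ n.+1.
  by rewrite exprS /D; field; exact: lt0r_neq0.
have -> : B (scons a x) + q * f (scons a x) - (B (scons a y) + q * f (scons a y)) =
  (B (scons a x) - B (scons a y)) + q * (f (scons a x) - f (scons a y)) by ring.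
apply: (le_trans (ler_normD _ _)); rewrite lerD// normrM ger0_norm//.
by apply: le_trans h2; rewrite ler_piMl.
Qed.

(* The equation [logsumexp (B + (1 - dl) f) = f] involves a contraction and is
   solved approximately by iteration; subtracting [f point] and letting [dl]
   tend to 0 yields the eigenfunction. *)
Lemma approximate_eigenfunction : exists c : R, forall dl : R, 0 < dl <= 1 ->
  exists (f : Omega -> R) (l : R), [/\ has_variation th D f, `|l| <= c, f point = 0 &
    forall x, `|logsumexp (fun z => B z + f z) x - f x - l| <= dl * (1 + D)].
Proof.
pose c : R := `|logsumexp B point| + D.
have Bc x : `|logsumexp B x| <= c.
  have /variation_logsumexp : 0 <= (0 : R) <= 1 by rewrite lexx ler01.
  move=> /(_ (fun=> 0)) h.
  have {}h : has_variation th D (logsumexp (fun z => B z + 0 * 0)).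
    by apply: h => n u v _; rewrite subrr normr0 mulr_ge0// exprn_ge0// ltW.
  have := variation_osc x point h.
  have -> : (fun z => B z + 0 * 0) = B by apply/funext => z; rewrite mulr0 addr0.
  move=> h'; rewrite /c -(subrK (logsumexp B point) (logsumexp B x)) addrC.
  by apply: (le_trans (ler_normD _ _)); rewrite lerD2l.
have c0 : 0 <= c by rewrite addr_ge0.
exists c => dl /andP[dl0 dl1]; pose q := 1 - dl.
have q0 : 0 <= q by rewrite subr_ge0.
have q1 : q < 1 by rewrite ltrBlDr ltrDl.
pose M f := logsumexp (fun z => B z + q * f z) : Omega -> R.
pose u k := iter k M (fun=> 0).
have uD k : has_variation th D (u k).
  elim: k => [n x y _|k IHk]; last by apply: variation_logsumexp; rewrite ?q0 ?ltW.
  by rewrite subrr normr0 mulr_ge0// exprn_ge0// ltW.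
have M_lip f g e : (forall x, `|f x - g x| <= e) -> forall x, `|M f x - M g x| <= q * e.
  move=> fg x; apply: logsumexp_dist => a.
  have -> : forall b s t : R, b + q * s - (b + q * t) = q * (s - t) by move=> *; ring.
  by rewrite normrM ger0_norm// ler_wpM2l.
have u1 x : u 1%N x = logsumexp B x.
  rewrite /u/= /M (_ : (fun z => B z + q * 0) = B)//.
  by apply/funext => z; rewrite mulr0 addr0.
have uS k x : `|u k.+1 x - u k x| <= q ^+ k * c.
  elim: k x => [|k IHk] x; first by rewrite u1 /u/= subr0 expr0 mul1r.
  by rewrite exprS -mulrA; exact: M_lip.
(* The bound c / dl is preserved by v |-> q v + c. It explodes as dl tends to 0, but only the
   oscillation of [u k], at most [D], and the product [dl * u k point] are used. *)
have ub k x : dl * `|u k x| <= c.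
  elim: k x => [|k IHk] x; first by rewrite /u/= normr0 mulr0.
  have h : `|M (u k) x - M (fun=> 0) x| <= q * (c / dl).
    by apply: M_lip => {}x; rewrite subr0 ler_pdivlMr// mulrC.
  have h' : `|u k.+1 x| <= q * (c / dl) + c.
    rewrite -(subrK (M (fun=> 0) x) (u k.+1 x)).
    apply: (le_trans (ler_normD _ _)); rewrite lerD//.
    by move: (Bc x); rewrite -u1.
  have -> : c = dl * (q * (c / dl) + c) by rewrite /q; field; exact: lt0r_neq0.
  by rewrite ler_pM2l.
have [k hk] : exists k, q ^+ k * c <= dl.
  have /cvgrPdist_lt /(_ _ dl0)[k _ /(_ k (leqnn _))] :
      @geometric R c q @ \oo --> 0 by apply: cvg_geometric; rewrite ger0_norm.
  rewrite /geometric/= sub0r normrN => h; exists k; rewrite mulrC.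
  exact: le_trans (ler_norm _) (ltW h).
(* With p = [u k point], q p = p - dl p: after centring at [point] the constant dl p is left over
   and acts as the logarithm of the eigenvalue. *)
exists (fun x => u k x - u k point), (dl * u k point); split.
- by move=> n x y xy; rewrite opprB addrA subrK; exact: uD.
- by rewrite normrM (gtr0_norm dl0).
- by rewrite subrr.
move=> x; pose p := u k point.
(* In [v] the centred function still carries the factor q; removing it costs dl times an
   oscillation, whence dl D. The remaining dl is the last step of the iteration. *)
pose v := logsumexp (fun z => (B z + q * u k z) + (- q * p)) x.
have h1 : `|logsumexp (fun z => B z + (u k z - p)) x - v| <= dl * D.
  apply: logsumexp_dist => a.
  have -> : B (scons a x) + (u k (scons a x) - p) - (B (scons a x) + q * u k (scons a x) + - q * p) =
    dl * (u k (scons a x) - p) by rewrite /q; ring.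
  by rewrite normrM (gtr0_norm dl0) ler_pM2l// (variation_osc _ _ (uD k)).
have h2 : `|u k.+1 x - u k x| <= dl := le_trans (uS k x) hk.
have vE : v = u k.+1 x - q * p by rewrite /v logsumexpD mulNr.
have -> : logsumexp (fun z => B z + (u k z - p)) x - (u k x - p) - dl * p =
  (logsumexp (fun z => B z + (u k z - p)) x - v) + (u k.+1 x - u k x).
  by rewrite vE /q; ring.
rewrite mulrDr mulr1 addrC; apply: (le_trans (ler_normD _ _)); exact: lerD.
Qed.

Lemma eigenfunction : exists (f : Omega -> R) (l : R), has_variation th D f /\
  forall x, \sum_a expR (B (scons a x) + f (scons a x) - f x - l) = 1.
Proof.
have [c hc] := approximate_eigenfunction.
have /choice[fl hfl] : forall n, exists fl : (Omega -> R) * R, [/\ has_variation th D fl.1, `|fl.2| <= c, fl.1 point = 0 &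
    forall x, `|logsumexp (fun z => B z + fl.1 z) x - fl.1 x - fl.2| <= n.+1%:R^-1 * (1 + D)].
  move=> n; have /hc[f [l h]] : 0 < (n.+1%:R^-1 : R) <= 1.
    by rewrite invr_gt0 ltr0n/= invf_le1// ler1n.
  by exists (f, l).
(* The ultrafilter refines [\oo], so the errors, which tend to 0 along [\oo], also do so along
   [U]. *)
have [U [UU ooU]] := ultraFilterLemma (@eventually_filter).
have /choice[f hf] : forall x, exists l : R, (fl n).1 x @[n --> U] --> l.
  move=> x; apply: (@ultralimit R U UU _ D) => n; have [h _ h0 _] := hfl n.
  by have := variation_osc x point h; rewrite h0 subr0.
have [l hl] : exists l : R, (fl n).2 @[n --> U] --> l.
  by apply: (@ultralimit R U UU _ c) => n; have [] := hfl n.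
have UF : Filter U by exact: ultra_proper.
exists f, l; split.
  move=> n x y xy.
  have h : `|(fl n).1 x - (fl n).1 y| @[n --> U] --> `|f x - f y|.
    by apply: cvg_norm; exact: cvgB.
  apply: (closed_cvg (fun z => z <= D * th ^+ n)) h; first exact: closed_le.
  by apply: nearW => k; have [h _ _ _] := hfl k; exact: h.
move=> x.
have h1 : logsumexp (fun z => B z + (fl n).1 z) x @[n --> U] --> logsumexp (fun z => B z + f z) x.
  have hs : \sum_a expR (B (scons a x) + (fl n).1 (scons a x)) @[n --> U] -->
      \sum_a expR (B (scons a x) + f (scons a x)).
    apply: cvg_big => [|a _]; first exact: add_continuous.
    have ha : B (scons a x) + (fl n).1 (scons a x) @[n --> U] --> B (scons a x) + f (scons a x).
      by apply: cvgD; [exact: cvg_cst|exact: hf].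
    exact: (continuous_cvg _ (@continuous_expR R _) ha).
  exact: (continuous_cvg _ (continuous_ln (sum_expR_gt0 (fun z => B z + f z) x)) hs).
have h2 : logsumexp (fun z => B z + (fl n).1 z) x - (fl n).1 x - (fl n).2 @[n --> U] -->
   logsumexp (fun z => B z + f z) x - f x - l.
  by apply: cvgB => //; apply: cvgB.
have h3 : logsumexp (fun z => B z + (fl n).1 z) x - (fl n).1 x - (fl n).2 @[n --> U] --> 0.
  apply/cvgrPdist_le => e e0.
  have /cvgrPdist_le /(_ _ e0) : n.+1%:R^-1 * (1 + D) @[n --> \oo] --> 0.
    by rewrite -(mul0r (1 + D)); apply: cvgM; [exact: cvg_harmonic|exact: cvg_cst].
  move=> /ooU; apply: filterS => n; rewrite !sub0r !normrN => h.
  by have [_ _ _ h'] := hfl n; exact: le_trans (h' x) (le_trans (ler_norm _) h).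
have s0 := sum_expR_gt0 (fun z => B z + f z) x.
have := cvg_unique _ h2 h3; rewrite /logsumexp.
set S := \sum_a _ in s0 * => h.
transitivity (S * expR (- (f x + l))).
  by rewrite mulr_suml; apply: eq_bigr => a _; rewrite -expRD opprD addrA.
rewrite -{1}(@lnK _ S) ?posrE// -expRD.
by rewrite opprD addrA h ?expR0//; exact: Rhausdorff.
Qed.

End eigenfunction.

(** * Contraction of the normalised operator *)

Section transfer_operator.
Context {R : realType} {d : nat}.
Local Notation Omega := (shift_space R d).
Variables (th K : R) (G : Omega -> R).
Hypotheses (th01 : 0 < th < 1) (GK : has_variation th K G).
Hypothesis G1 : forall x, \sum_a expR (G (scons a x)) = 1.
Implicit Types (f u : Omega -> R) (x y : Omega).

Let th0 : 0 < th. Proof. by case/andP: th01. Qed.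
Let th1 : 0 < 1 - th. Proof. by rewrite subr_gt0; case/andP: th01. Qed.

Let K_ge0 : 0 <= K.
Proof. exact: le_trans (variation_osc point point GK). Qed.

Definition transfer f x : R := \sum_a expR (G (scons a x)) * f (scons a x).

Lemma transfer_le f u x : (forall y, f y <= u y) -> transfer f x <= transfer u x.
Proof. by move=> fu; apply: ler_sum => a _; rewrite ler_pM2l ?expR_gt0. Qed.

Lemma transfer_cst c x : transfer (fun=> c) x = c.
Proof. by rewrite /transfer -mulr_suml G1 mul1r. Qed.

Lemma transferD f u : transfer (fun x => f x + u x) = (fun x => transfer f x + transfer u x).
Proof.
by apply/funext => x; rewrite /transfer -big_split; apply: eq_bigr => a _; rewrite mulrDr.
Qed.

Lemma transferZ c f : transfer (fun x => c * f x) = (fun x => c * transfer f x).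
Proof.
by apply/funext => x; rewrite /transfer mulr_sumr; apply: eq_bigr => a _; rewrite mulrCA.
Qed.

Lemma transferDc f c : transfer (fun x => f x + c) = (fun x => transfer f x + c).
Proof. by rewrite transferD; apply/funext => x; rewrite transfer_cst. Qed.

Lemma iter_transfer_le k f u x : (forall y, f y <= u y) ->
  iter k transfer f x <= iter k transfer u x.
Proof. by move=> fu; elim: k x => //= k IHk x; exact: transfer_le. Qed.

Lemma iter_transfer_cst k c x : iter k transfer (fun=> c) x = c.
Proof.
elim: k x => //= k IHk x; rewrite (_ : iter _ _ _ = fun=> c) ?transfer_cst//.
exact/funext.
Qed.

Lemma iter_transferZ k c f :
  iter k transfer (fun x => c * f x) = (fun x => c * iter k transfer f x).
Proof. by elim: k => //= k ->; rewrite transferZ. Qed.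

Lemma iter_transferDc k f c :
  iter k transfer (fun x => f x + c) = (fun x => iter k transfer f x + c).
Proof. by elim: k => //= k ->; rewrite transferDc. Qed.

(** Positive functions whose logarithm has variation [D * th ^+ n]; the reverse inequality follows
    by symmetry of [agree]. *)
Definition log_cone (D : R) u := (forall x, 0 < u x) /\
  forall n x y, agree n x y -> u x <= expR (D * th ^+ n) * u y.

Lemma log_cone_transfer D u : log_cone D u -> log_cone ((K + D) * th) (transfer u).
Proof.
move=> [u0 uD]; split => [x|n x y xy].
  rewrite /transfer (bigD1 ord0)//= ltr_wpDr ?mulr_gt0 ?expR_gt0//.
  by apply: sumr_ge0 => a _; rewrite mulr_ge0 ?expR_ge0// ltW.
rewrite /transfer mulr_sumr; apply: ler_sum => a _.
have axy := agree_scons a xy.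
have h1 : expR (G (scons a x)) <= expR (K * th ^+ n.+1) * expR (G (scons a y)).
  rewrite -expRD ler_expR -lerBlDr; exact: le_trans (ler_norm _) (GK axy).
have h2 := uD _ _ _ axy.
apply: (le_trans (ler_pM (expR_ge0 _) (ltW (u0 _)) h1 h2)).
by rewrite mulrACA -expRD -mulrDl exprS [_ * (th * _)]mulrA.
Qed.

(* Any [D] with [(K + D) th < D] would do. *)
Let D := (K * th + 1) / (1 - th).

Let D_ge1 : 1 <= D.
Proof.
rewrite /D ler_pdivlMr// mul1r (@le_trans _ _ 1)//; first by rewrite lerBlDr lerDl ltW.
by rewrite lerDr mulr_ge0// ltW.
Qed.

Let D_gt0 : 0 < D. Proof. exact: lt_le_trans ltr01 D_ge1. Qed.

Let KD : (K + D) * th = D - 1.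
Proof. by rewrite /D; field; exact: lt0r_neq0. Qed.

(** For 0 <= s <= 1, exp (D s) - 1 <= D s exp D; thus t (exp (D s) - 1) <= s. *)
Let t := (D * expR D)^-1.

Let t_gt0 : 0 < t.
Proof. by rewrite invr_gt0 (mulr_gt0 D_gt0 (expR_gt0 _)). Qed.

Let t_lt1 : t < 1.
Proof.
rewrite invf_lt1 ?(mulr_gt0 D_gt0 (expR_gt0 _))//.
have h : 1 < expR D by rewrite expR_gt1 D_gt0.
by apply: (lt_le_trans h); rewrite ler_peMl ?expR_ge0.
Qed.

(** With a = exp (D s) and b = exp ((D - 1) s), it suffices that c (a - 1) <= (a - b) u(y). The gap
    between the exponents gives a - b >= s, and the choice of [t] gives t (a - 1) <= s. *)
Lemma log_cone_subc u c : log_cone (D - 1) u -> (forall y, c <= t * u y) -> 0 <= c ->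
  log_cone D (fun x => u x - c).
Proof.
move=> [u0 uD] cu c0; split => [x|n x y xy].
  by rewrite subr_gt0 (le_lt_trans (cu x))// gtr_pMl.
set s := th ^+ n; have s0 : 0 < s by rewrite exprn_gt0.
have s1 : s <= 1 by rewrite exprn_ile1 ?(ltW th0)//; case/andP: th01 => _ /ltW.
have D0 := D_gt0.
set a := expR (D * s); set b := expR ((D - 1) * s).
have h1 : s <= a - b.
  have -> : a - b = b * (expR s - 1).
    by rewrite mulrBr mulr1 /a /b -expRD mulrBl mul1r subrK.
  have hs : s <= expR s - 1 by rewrite lerBrDr addrC expR_ge1Dx.
  apply: (le_trans hs); rewrite ler_peMl ?(le_trans (ltW s0))//.
  by rewrite -[leLHS]expR0 ler_expR mulr_ge0 ?(ltW s0)// subr_ge0.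
have h2 : t * (a - 1) <= s.
  have h3 : a - 1 <= D * s * a by exact: expR_sub1_le.
  have h4 : a <= expR D by rewrite ler_expR ler_piMr ?(ltW D0).
  rewrite /t mulrC ler_pdivrMr ?(mulr_gt0 D0 (expR_gt0 _))//; apply: (le_trans h3).
  by rewrite mulrA [s * D]mulrC (ler_pM2l (mulr_gt0 D0 s0)).
have a1 : 0 <= a - 1 by rewrite subr_ge0 -[leLHS]expR0 ler_expR mulr_ge0 ?ltW.
have h5 : c * (a - 1) <= t * u y * (a - 1) by rewrite ler_wpM2r.
have h6 : t * u y * (a - 1) <= u y * (a - b).
  rewrite mulrAC [leRHS]mulrC ler_pM2r//; exact: le_trans h1.
have h7 := uD _ _ _ xy.
by rewrite -/s -/b in h7; lra.
Qed.

(** One factor exp (- D) puts the removed constant below [t] times the infimum, the other compares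
    the value at [point] with the supremum. *)
Let kappa := t * expR (- 2 * D).

Let kappa01 : 0 < kappa <= 1.
Proof.
rewrite mulr_gt0 ?expR_gt0//= mulr_ile1 ?expR_ge0 ?(ltW t_gt0) ?(ltW t_lt1)//.
by rewrite -[leRHS]expR0 ler_expR mulNr oppr_le0 mulr_ge0// (le_trans ler01).
Qed.

Lemma log_cone_transfer_subc u M : log_cone D u -> (forall x, u x <= M) ->
  exists c, log_cone D (fun x => transfer u x - c) /\
    forall x, transfer u x - c <= (1 - kappa) * M.
Proof.
move=> Du uM; have := log_cone_transfer Du; rewrite KD => Lu.
have [Lu0 LuD] := Lu.
have osc x y : expR (- D) * transfer u x <= transfer u y.
  have /LuD : agree 0 x y by [].
  rewrite expr0 mulr1 => h.
  have h' : transfer u x <= expR D * transfer u y.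
    apply: (le_trans h); rewrite ler_pM2r// ler_expR lerBlDr lerDl; exact: ler01.
  by rewrite expRN mulrC ler_pdivrMr ?expR_gt0// mulrC.
exists (t * (expR (- D) * transfer u point)); split.
  apply: log_cone_subc => // [y|]; first by rewrite ler_pM2l.
  by rewrite !mulr_ge0 ?(ltW t_gt0) ?expR_ge0// ltW.
move=> x.
have h1 : kappa * transfer u x <= t * (expR (- D) * transfer u point).
  rewrite /kappa (_ : - 2 * D = - D + - D); last by ring.
  rewrite expRD -!mulrA ler_pM2l// ler_pM2l ?expR_gt0//; exact: osc.
have h2 : transfer u x <= M.
  rewrite -[leRHS](transfer_cst M x); exact: transfer_le.
have : (1 - kappa) * transfer u x <= (1 - kappa) * M.
  by rewrite ler_wpM2l// subr_ge0; case/andP: kappa01.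
by lra.
Qed.

(* [transfer] maps [log_cone D] into [log_cone (D - 1)], where a fixed proportion
   of the function can be removed as a constant without leaving [log_cone D]. *)
Lemma iter_transfer_log_cone u M k : log_cone D u -> (forall x, u x <= M) ->
  exists c, log_cone D (fun x => iter k transfer u x - c) /\
    forall x, iter k transfer u x - c <= (1 - kappa) ^+ k * M.
Proof.
move=> Du uM; elim: k => [|k [c [Dk kM]]].
  exists 0; split => [|x]; last by rewrite subr0 expr0 mul1r.
  by rewrite (_ : (fun _ => _) = u)//; apply/funext => x; rewrite subr0.
have [c' [Dk' kM']] := log_cone_transfer_subc Dk kM.
rewrite transferDc in Dk' kM'.
exists (c + c'); split.
  rewrite (_ : (fun _ => _) = (fun x => transfer (fun y => iter k transfer u y) x - c - c'))//.
  by apply/funext => x/=; rewrite opprD addrA.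
by move=> x; rewrite exprS -mulrA opprD addrA; exact: kM'.
Qed.

Lemma log_cone_variation u M : log_cone D u -> (forall x, u x <= M) ->
  has_variation th (D * expR D * M) u.
Proof.
move=> [u0 uD] uM n; have D0 := D_gt0.
suff h x y : agree n x y -> u x - u y <= D * expR D * M * th ^+ n.
  move=> x y xy; rewrite ler_norml lerNl opprB !h//; exact: agree_sym.
move=> /uD; set s := th ^+ n => h.
have s0 : 0 < s by rewrite exprn_gt0.
have s1 : s <= 1 by rewrite exprn_ile1 ?(ltW th0)//; case/andP: th01 => _ /ltW.
set a := expR (D * s) in h.
have h3 : a - 1 <= D * s * a by exact: expR_sub1_le.
have h4 : a <= expR D by rewrite ler_expR ler_piMr ?(ltW D0).
have h5 : D * s * a <= D * s * expR D by rewrite (ler_pM2l (mulr_gt0 D0 s0)).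
have h6 : (a - 1) * u y <= (D * s * expR D) * M.
  by apply: ler_pM => //; [rewrite subr_ge0 -[leLHS]expR0 ler_expR mulr_ge0 ?ltW|exact: ltW|exact: le_trans h5].
have -> : D * expR D * M * s = (D * s * expR D) * M by ring.
by lra.
Qed.

Lemma variation_log_cone C f : has_variation th C f ->
  exists N M, log_cone D (fun x => f x + N) /\ forall x, f x + N <= M.
Proof.
move=> fC; have C0 : 0 <= C := le_trans (normr_ge0 _) (variation_osc point point fC).
have D0 := D_gt0.
have fp x : f point - C <= f x <= f point + C.
  by have := variation_osc x point fC; rewrite ler_distl.
(* This makes [f + N] at least 1 + C; as [D >= 1], the oscillation C s is then at most D s (f +
   N). *)
pose N := C + 1 + C - f point; exists N, (f point + C + N).
have fN x : 1 + C <= f x + N by case/andP: (fp x); rewrite /N; lra.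
split; last by move=> x; rewrite lerD2r; case/andP: (fp x).
split => [x|n x y xy]; first by apply: lt_le_trans (fN x); rewrite ltr_wpDr.
set s := th ^+ n; have s0 : 0 < s by rewrite exprn_gt0.
have h1 : f x - f y <= C * s := le_trans (ler_norm _) (fC n x y xy).
have h2 : 1 + D * s <= expR (D * s) by exact: expR_ge1Dx.
have h3 : (1 + D * s) * (f y + N) <= expR (D * s) * (f y + N).
  by rewrite ler_wpM2r// (le_trans _ (fN y))// addr_ge0.
have h4 : C * s <= D * s * (f y + N).
  rewrite mulrAC ler_wpM2r ?(ltW s0)//.
  apply: (@le_trans _ _ (f y + N)); first by apply: le_trans (fN y); rewrite lerDr.
  by rewrite ler_peMl// (le_trans _ (fN y))// addr_ge0.
by lra.
Qed.

(** The bound is uniform in k because [log_cone D] is stable and averaging does not raise an upper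
    bound. *)
Lemma iter_transfer_variation C f : has_variation th C f ->
  exists C', forall k, has_variation th C' (iter k transfer f).
Proof.
move=> /variation_log_cone[N [M [Df fM]]]; exists (D * expR D * M) => k n x y xy.
have Dk : log_cone D (iter k transfer (fun x => f x + N)).
  elim: k => // k IHk; rewrite [iter _ _ _]/=.
  have [L0 LD] := log_cone_transfer IHk; split => // m u v uv.
  apply: (le_trans (LD _ _ _ uv)); rewrite KD ler_pM2r// ler_expR.
  by rewrite ler_wpM2r ?exprn_ge0 ?(ltW th0)// lerBlDr lerDl ler01.
have kM z : iter k transfer (fun x => f x + N) z <= M.
  by rewrite -[leRHS](iter_transfer_cst k M z); exact: iter_transfer_le.
have := log_cone_variation Dk kM xy.
by rewrite iter_transferDc opprD addrACA subrr addr0.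
Qed.

(** Later iterates average earlier ones, so from k on all values stay in an interval containing the
    range of the k-th iterate, of length decaying geometrically in k. *)
Lemma iter_transfer_contract C f : has_variation th C f ->
  exists M, forall k l x y, (k <= l)%N ->
    `|iter l transfer f x - iter k transfer f y| <= (1 - kappa) ^+ k * M.
Proof.
move=> /variation_log_cone[N [M [Df fM]]]; exists M => k l x y kl.
have [c [[ck0 _] ckM]] := iter_transfer_log_cone k Df fM.
set q := (1 - kappa) ^+ k * M in ckM *.
have lo z : c - N <= iter k transfer f z.
  by have := ck0 z; rewrite iter_transferDc; lra.
have hi z : iter k transfer f z <= c - N + q.
  by have := ckM z; rewrite iter_transferDc; lra.
have lol : c - N <= iter l transfer f x.
  rewrite -(subnK kl) iterD -[leLHS](iter_transfer_cst (l - k) _ x).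
  exact: iter_transfer_le.
have hil : iter l transfer f x <= c - N + q.
  rewrite -(subnK kl) iterD -[leRHS](iter_transfer_cst (l - k) _ x).
  exact: iter_transfer_le.
have := lo y; have := hi y; rewrite ler_norml; lra.
Qed.

Let cvg_kappa M : (1 - kappa) ^+ k * M @[k --> \oo] --> 0.
Proof.
rewrite -(mul0r M); apply: cvgM; last exact: cvg_cst.
apply: cvg_expr; have /andP[k0 k1] := kappa01.
by rewrite ger0_norm ?subr_ge0// ltrBlDr ltrDl.
Qed.

Lemma iter_transfer_cvg C f : has_variation th C f ->
  exists c, forall e, 0 < e ->
    exists k0, forall k x, (k0 <= k)%N -> `|iter k transfer f x - c| <= e.
Proof.
move=> fC; have [M hM] := iter_transfer_contract fC.
have cv : cvgn (fun k => iter k transfer f point).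
  apply: cauchy_cvg; apply/cauchy_ballP => e e0.
  have e2 : 0 < e / 2 by rewrite divr_gt0.
  have /cvgrPdist_lt /(_ _ e2)[k _ /(_ k (leqnn k))] := cvg_kappa M.
  rewrite sub0r normrN => hk.
  have hk' l : (k <= l)%N -> `|iter l transfer f point - iter k transfer f point| < e / 2.
    by move=> kl; apply: le_lt_trans hk; exact: le_trans (hM _ _ _ _ kl) (ler_norm _).
  exists ([set z | `|z - iter k transfer f point| < e / 2], [set z | `|z - iter k transfer f point| < e / 2]).
    by split; exists k => // l /= kl; exact: hk'.
  move=> [a b] [/= ha hb]; rewrite /ball/=.
  have -> : a - b = (a - iter k transfer f point) - (b - iter k transfer f point) by ring.
  by rewrite (splitr e) (le_lt_trans (ler_normB _ _))// ltrD.
exists (limn (fun k => iter k transfer f point)) => e e0.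
have e2 : 0 < e / 2 by rewrite divr_gt0.
have /cvgrPdist_le /(_ _ e2)[k1 _ h1] := cv.
have /cvgrPdist_le /(_ _ e2)[k2 _ h2] := cvg_kappa M.
exists (maxn k1 k2) => k x; rewrite geq_max => /andP[k1k k2k].
have := h1 k k1k; have := h2 k k2k; rewrite /= sub0r normrN => hk2 hk1.
have hx := le_trans (hM k k x point (leqnn k)) (le_trans (ler_norm _) hk2).
rewrite (splitr e) -(subrKA (iter k transfer f point)).
by apply: (le_trans (ler_normD _ _)); rewrite lerD// distrC.
Qed.

End transfer_operator.

(** * The variational principle and equilibrium states *)

Section relative_entropy.
Context {R : realType} {I : finType}.
Variables (p q : I -> R).
Hypotheses (p0 : forall i, 0 <= p i) (q0 : forall i, 0 <= q i).
Hypotheses (p1 : \sum_i p i = 1) (q1 : \sum_i q i = 1).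
Hypothesis pq : forall i, 0 < p i -> 0 < q i.

Definition relative_entropy := \sum_i p i * (ln (p i) - ln (q i)).

(** A Hellinger bound. It holds term by term once q - p, of total mass 0, is added: with s and t the
    square roots, use ln (s / t) >= 1 - t / s. *)
Lemma sum_sqr_sqrt_le : \sum_i (Num.sqrt (p i) - Num.sqrt (q i)) ^+ 2 <= relative_entropy.
Proof.
have -> : relative_entropy = \sum_i (p i * (ln (p i) - ln (q i)) + q i - p i).
  by rewrite sumrB big_split/= p1 q1 addrK.
apply: ler_sum => i _.
have [pi0|pi_neq0] := eqVneq (p i) 0.
  by rewrite pi0 mul0r add0r subr0 sqrtr0 sub0r sqrrN sqr_sqrtr.
have pi_gt0 : 0 < p i by rewrite lt0r pi_neq0 p0.
have qi_gt0 := pq pi_gt0.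
set s := Num.sqrt (p i); set t := Num.sqrt (q i).
have s0 : 0 < s by rewrite sqrtr_gt0.
have t0 : 0 < t by rewrite sqrtr_gt0.
have pE : p i = s ^+ 2 by rewrite sqr_sqrtr.
have qE : q i = t ^+ 2 by rewrite sqr_sqrtr.
have := ln_ge1BV (divr_gt0 s0 t0); rewrite invf_div ln_div ?posrE// => h.
rewrite pE qE !lnXn// -mulrnBl.
have h2 : s ^+ 2 * ((1 - t / s) *+ 2) <= s ^+ 2 * ((ln s - ln t) *+ 2).
  by rewrite ler_pM2l ?exprn_gt0// lerMn2r h orbT.
have h3 : s ^+ 2 * ((1 - t / s) *+ 2) = 2 * s ^+ 2 - 2 * s * t.
  by rewrite mulr2n; field; exact: lt0r_neq0.
by rewrite sqrrB; move: h2 h3; rewrite -mulr_natl; lra.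
Qed.

Lemma relative_entropy_ge0 : 0 <= relative_entropy.
Proof. by apply: le_trans sum_sqr_sqrt_le; apply: sumr_ge0 => i _; exact: sqr_ge0. Qed.

(* Pinsker's inequality, with a worse constant *)
Lemma sum_dist_le_relative_entropy (t : R) : 0 < t ->
  \sum_i `|p i - q i| <= relative_entropy / t + 2 * t.
Proof.
move=> t0.
apply: (@le_trans _ _ ((\sum_i (Num.sqrt (p i) - Num.sqrt (q i)) ^+ 2) / t + 2 * t)); last first.
  by rewrite lerD2r ler_pM2r ?invr_gt0// sum_sqr_sqrt_le.
have -> : 2 * t = \sum_i t * (p i + q i).
  by rewrite -mulr_sumr big_split/= p1 q1 mulrC.
rewrite mulr_suml -big_split/=; apply: ler_sum => i _.
set u := Num.sqrt (p i); set v := Num.sqrt (q i).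
have u0 : 0 <= u by exact: sqrtr_ge0.
have v0 : 0 <= v by exact: sqrtr_ge0.
have -> : p i = u ^+ 2 by rewrite sqr_sqrtr.
have -> : q i = v ^+ 2 by rewrite sqr_sqrtr.
rewrite subr_sqr normrM [`|u + v|]ger0_norm ?addr_ge0//.
set z := `|u - v|.
have -> : (u - v) ^+ 2 = z ^+ 2 by rewrite /z real_normK ?num_real.
(* AM-GM: z (u + v) <= z^2 / (2 t) + t (u + v)^2 / 2; the free parameter [t] replaces a square
   root. *)
have h1 : 0 <= (z - t * (u + v)) ^+ 2 / (2 * t) by rewrite divr_ge0 ?sqr_ge0 ?mulr_ge0 ?ltW.
have h2 : (z - t * (u + v)) ^+ 2 / (2 * t) = z ^+ 2 / t / 2 - z * (u + v) + t * (u + v) ^+ 2 / 2.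
  by field; exact: lt0r_neq0.
have h3 : t * (u + v) ^+ 2 / 2 <= t * (u ^+ 2 + v ^+ 2).
  rewrite -mulrA ler_pM2l//; have := sqr_ge0 (u - v); rewrite sqrrB sqrrD; lra.
have h4 : 0 <= z ^+ 2 / t by rewrite divr_ge0 ?sqr_ge0// ltW.
lra.
Qed.

End relative_entropy.

(** * Integrals approximated by finite sums *)

Section integrals.
Context {R : realType} {d : nat}.
Local Notation Omega := (shift_space R d).
Variable (rho : probability Omega R).
Implicit Types f : Omega -> R.

Lemma variation_measurable th C f : 0 < th < 1 -> has_variation th C f ->
  measurable_fun setT f.
Proof.
move=> /andP[th0 th1] fC mD; apply: (measurability _ (measurable_realfun.RGenOInfty.measurableE R)) => //.
move=> /= _ [_ [a ->] <-]; rewrite setTI.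
rewrite (_ : _ @^-1` _ = \bigcup_n [set x | forall y, agree n x y -> a < f y]).
  apply: bigcup_measurable => n _; apply: (@measurable_depends_on _ _ n) => x y xy /= h z yz.
  by apply: h; exact: agree_trans yz.
apply/seteqP; split => [x|x [n _ h]] /=; rewrite in_itv/= andbT; last exact: h.
rewrite -subr_gt0 => ax.
have /cvgrPdist_lt /(_ _ ax)[n _ /(_ n (leqnn _))] : C * th ^+ n @[n --> \oo] --> 0.
  rewrite -(mulr0 C); apply: cvgM; first exact: cvg_cst.
  by apply: cvg_expr; rewrite gtr0_norm.
rewrite sub0r normrN => /(le_lt_trans (ler_norm _)) hn; exists n => //= y xy.
have := le_trans (ler_norm _) (fC _ _ _ xy); lra.
Qed.

Lemma variation_integrable th C f : 0 < th < 1 -> has_variation th C f ->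
  rho.-integrable setT (EFin \o f).
Proof.
move=> th01 fC; apply: measurable_bounded_integrable => //.
- by rewrite (le_lt_trans (probability_le1 _ _)) ?ltry.
- exact: variation_measurable fC.
exists (`|f point| + C); split; first exact: num_real.
move=> M hM x _ /=; apply: le_trans (ltW hM); exact: variation_bound fC.
Qed.

Lemma label_integrable (I : finType) (xi : Omega -> I) (phi : I -> R) :
  measurable_partition xi -> rho.-integrable setT (EFin \o (phi \o xi)).
Proof.
move=> mxi; apply: measurable_bounded_integrable => //.
- by rewrite (le_lt_trans (probability_le1 _ _)) ?ltry.
- by move=> _ Y mY; rewrite setTI comp_preimage; exact: preimage_label_measurable.
exists (\sum_i `|phi i|); split; first exact: num_real.
move=> M hM x _ /=; apply: le_trans (ltW hM).
by rewrite (bigD1 (xi x))//= lerDl sumr_ge0.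
Qed.

Lemma Rintegral_label (I : finType) (xi : Omega -> I) (phi : I -> R) :
  measurable_partition xi ->
  \int[rho]_x phi (xi x) = \sum_i weight rho xi i * phi i.
Proof.
move=> mxi; rewrite /Rintegral.
have iI i : rho.-integrable setT (EFin \o \1_(xi @^-1` [set i])).
  exact: integrable_indic.
under eq_integral => x _.
  rewrite (_ : phi (xi x) = \sum_i phi i * \1_(xi @^-1` [set i]) x); last first.
    rewrite (bigD1 (xi x))//= big1 ?addr0.
      by rewrite indicE mem_set// mulr1.
    by move=> i ixi; rewrite indicE memNset ?mulr0//= => /esym/eqP; rewrite (negbTE ixi).
  rewrite -sumEFin; under eq_bigr do rewrite EFinM.
  over.
rewrite integral_sum//=; last by move=> i; apply: integrableZl => //; exact: iI.
rewrite -sum_fine; last first.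
  move=> i _; apply: integrable_fin_num => //; apply: integrableZl => //; exact: iI.
apply: eq_bigr => i _; rewrite (integralZl measurableT (iI i)) integral_indic// setIT fineM//.
  by rewrite mulrC.
by rewrite fin_num_measure.
Qed.

Lemma Rintegral_label_approx (I : finType) (xi : Omega -> I) (phi : I -> R) th C f e :
  0 < th < 1 -> has_variation th C f -> measurable_partition xi ->
  (forall x, `|f x - phi (xi x)| <= e) ->
  `|\int[rho]_x f x - \sum_i weight rho xi i * phi i| <= e.
Proof.
move=> th01 fC mxi fphi; rewrite -Rintegral_label//.
have iphi := label_integrable phi mxi.
have if' := variation_integrable th01 fC.
rewrite -RintegralB//.
have ifphi : rho.-integrable setT (EFin \o (fun x => f x - phi (xi x))) by exact: (integrableB measurableT if' iphi).
apply: (le_trans (le_normr_Rintegral _ ifphi)) => //.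
have -> : e = \int[rho]_(x in setT) e.
  rewrite Rintegral_cst// (_ : fine _ = 1) ?mulr1//.
  by rewrite (_ : _ setT = 1%E)//; exact: probability_setT.
apply: le_Rintegral => //; first exact: integrable_norm.
exact: finite_measure_integrable_cst.
Qed.

(** A representative point of each cylinder, padded with [ord0]. *)
Definition extend n (w : {ffun 'I_n -> 'I_d.+1}) : Omega :=
  fun i => if insub i is Some j then w j else ord0.

Lemma agree_extend n (x : Omega) : agree n x (extend (word n x)).
Proof. by move=> i ni; rewrite /extend insubT wordE. Qed.

Lemma word_extend n (w : {ffun 'I_n -> 'I_d.+1}) : word n (extend w) = w.
Proof. by apply/ffunP => j; rewrite wordE /extend valK. Qed.

End integrals.

(** * The Gibbs inequality and its equality case *)

Section gibbs_inequality.
Context {R : realType} {d : nat}.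
Local Notation Omega := (shift_space R d).
Variables (th K : R) (G : Omega -> R).
Hypotheses (th01 : 0 < th < 1) (GK : has_variation th K G).
Hypothesis G1 : forall x, \sum_a expR (G (scons a x)) = 1.
Variable (rho : probability Omega R).
Hypothesis rhoT : shift_invariant rho.

Let th0 : 0 < th. Proof. by case/andP: th01. Qed.

(** The word of length n + 1 cut after its first letter, so that (x_2, ..., x_{n+1}) is the factor
    [snd]. *)
Definition letter_word n (x : Omega) := (letter x, word n (shift_map x)).

Lemma measurable_letter_word n : measurable_partition (letter_word n).
Proof.
apply: measurable_partition_pair; first exact: measurable_partition_letter.
have mw : measurable_partition (word n : Omega -> _) by exact: measurable_partition_word.
exact: (measurable_partition_map (@measurable_shift_map R d) mw).
Qed.

Let p n := weight rho (letter_word n).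
(** The word is distributed as under [rho], and a letter is put in front of it with probabilities
    exp G, evaluated at the representative of the cylinder. *)
Let q n (u : 'I_d.+1 * {ffun 'I_n -> 'I_d.+1}) : R :=
  weight rho (word n) u.2 * expR (G (scons u.1 (extend u.2))).
Arguments q : clear implicits.
Arguments p : clear implicits.

Lemma letter_word_approx n C f x : has_variation th C f ->
  `|f x - f (scons (letter_word n x).1 (extend (letter_word n x).2))| <= C * th ^+ n.+1.
Proof.
by move=> fC; apply: fC => -[//|i]; rewrite ltnS => /(agree_extend (shift_map x)).
Qed.

Let q_ge0 n u : 0 <= q n u.
Proof. by rewrite mulr_ge0 ?weight_ge0 ?expR_ge0. Qed.

Let weight_shift n w : weight rho (snd \o letter_word n) w = weight rho (word n) w.
Proof.
rewrite /weight (_ : _ @^-1` _ = shift_map @^-1` (word n @^-1` [set w]))//.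
by rewrite rhoT//; exact: measurable_partition_word.
Qed.

Let q_sum n : \sum_u q n u = 1.
Proof.
have mw : measurable_partition (word n : Omega -> _) by exact: measurable_partition_word.
rewrite -(sum_weight rho mw) (eq_bigr (fun u => q n (u.1, u.2))); last by case.
rewrite -(pair_bigA _ (fun a w => q n (a, w)))/= exchange_big/=.
by apply: eq_bigr => w _; rewrite /q/= -mulr_sumr G1 mulr1.
Qed.

Let p_sum n : \sum_u p n u = 1.
Proof. by have := sum_weight rho (@measurable_letter_word n). Qed.

Let pq n u : 0 < p n u -> 0 < q n u.
Proof.
move=> pu; rewrite mulr_gt0 ?expR_gt0// -weight_shift (lt_le_trans pu)//.
exact: (weight_le_factor rho snd u (@measurable_letter_word n)).
Qed.

Let D n := relative_entropy (p n) (q n).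

(** Here ln q is the log-weight of the word plus G, so what remains besides the mean of G is minus
    the entropy of the letter given the word. *)
Let DE n : D n = - entropy_increment rho shift_map letter n -
  \sum_u p n u * G (scons u.1 (extend u.2)).
Proof.
have ml : measurable_partition (letter : Omega -> _) by exact: measurable_partition_letter.
rewrite /entropy_increment (partition_entropy_joinS (@measurable_shift_map R d) rhoT)//.
rewrite /conditional_entropy -/(word n).
rewrite [partition_entropy _ (fun _ => _)](_ : _ = partition_entropy rho (id \o letter_word n))//.
rewrite (_ : word n \o shift_map = snd \o letter_word n)//.
have mlw : measurable_partition (letter_word n) by exact: measurable_letter_word.
rewrite !partition_entropy_factor// opprD !opprK -sumrB -sumrB.
rewrite /D /relative_entropy; apply: eq_bigr => u _.
rewrite -/(p n u).
have [->|pu0] := eqVneq (p n u) 0; first by rewrite !mul0r !subr0.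
have pu : 0 < p n u by rewrite lt0r pu0 weight_ge0.
have := pq pu; rewrite /q pmulr_lgt0 ?expR_gt0// => ru.
rewrite lnM ?posrE ?expR_gt0// expRK weight_shift.
by ring.
Qed.

Let G_approx n : `|\int[rho]_x G x - \sum_u p n u * G (scons u.1 (extend u.2))| <= K * th ^+ n.+1.
Proof.
apply: (Rintegral_label_approx (phi := fun u => G (scons u.1 (extend u.2))) rho th01 GK).
  exact: measurable_letter_word.
by move=> x; exact: letter_word_approx.
Qed.

Let h := entropy_of_partition rho shift_map letter.

Let h_le n : h <= entropy_increment rho shift_map letter n.
Proof.
have ml : measurable_partition (letter : Omega -> _) by exact: measurable_partition_letter.
exact: (entropy_of_partition_le_increment (@measurable_shift_map R d) rhoT).
Qed.

Let cvg_th C : C * th ^+ n @[n --> \oo] --> 0.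
Proof.
rewrite -(mulr0 C); apply: cvgM; first exact: cvg_cst.
by apply: cvg_expr; rewrite gtr0_norm//; case/andP: th01.
Qed.

Lemma gibbs_inequality : h + \int[rho]_x G x <= 0.
Proof.
have cv : K * th * th ^+ n @[n --> \oo] --> 0 by exact: cvg_th.
apply: (ler_cvg_to (cvg_cst (h + \int[rho]_x G x)) cv); apply: nearW => n.
have := relative_entropy_ge0 (weight_ge0 rho _) (@q_ge0 n) (p_sum n) (q_sum n) (@pq n).
rewrite -/(D n) DE.
have := G_approx n; rewrite ler_distl => /andP[_]; have := h_le n.
by rewrite exprS mulrA; lra.
Qed.

Lemma gibbs_equality : (forall e, 0 < e -> exists n0, forall n, (n0 <= n)%N -> D n <= e) ->
  h + \int[rho]_x G x = 0.
Proof.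
move=> De; apply/eqP; rewrite eq_le gibbs_inequality/=.
have ml : measurable_partition (letter : Omega -> _) by exact: measurable_partition_letter.
rewrite -lerBlDr sub0r /h (entropy_of_partitionE (@measurable_shift_map R d) rhoT ml).
apply/ler_addgt0Pr => e e0; have e2 : 0 < e / 2 by rewrite divr_gt0.
rewrite -lerBlDr; apply: limr_ge.
  exact: entropy_increment_cvg (@measurable_shift_map R d) rhoT _ _ ml.
have [n0 hn0] := De _ e2.
have /cvgrPdist_le /(_ _ e2)[n1 _ hn1] := cvg_th (K * th).
exists (maxn n0 n1) => // n; rewrite /= geq_max => /andP[n0n n1n].
have := hn0 _ n0n; rewrite DE => h1.
have := hn1 _ n1n; rewrite /= sub0r normrN => /(le_trans (ler_norm _)) h2.
have := G_approx n; rewrite ler_distl => /andP[h3 _].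
by move: h3; rewrite exprS mulrA; lra.
Qed.

(** Equality forces [D n] below K th^(n+1), as the increments dominate [h]; by Pinsker p and q
    merge. Up to vanishing errors, f has mean rho (f) under p and rho (transfer G f) under q. *)
Lemma gibbs_transfer C f : h + \int[rho]_x G x = 0 -> has_variation th C f ->
  (exists C', has_variation th C' (transfer G f)) ->
  \int[rho]_x f x = \int[rho]_x transfer G f x.
Proof.
move=> hG fC [C' LfC].
pose F := `|f point| + C.
have fF x : `|f x| <= F by exact: variation_bound fC.
have F0 : 0 <= F := le_trans (normr_ge0 _) (fF point).
have Dn n : D n <= K * th * th ^+ n.
  rewrite DE; have := G_approx n; rewrite ler_distl => /andP[_ h3]; have := h_le n.
  by move: h3 hG; rewrite exprS mulrA; lra.
have mw n : measurable_partition (word n : Omega -> _) by exact: measurable_partition_word.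
have bnd t n : 0 < t -> `|\int[rho]_x f x - \int[rho]_x transfer G f x| <=
    (C * th + C' + F * (K * th / t)) * th ^+ n + F * (2 * t).
  move=> t0.
  have h1 : `|\int[rho]_x f x - \sum_u p n u * f (scons u.1 (extend u.2))| <= C * th ^+ n.+1.
    apply: (Rintegral_label_approx (phi := fun u => f (scons u.1 (extend u.2))) rho th01 fC).
      exact: measurable_letter_word.
    by move=> x; exact: letter_word_approx.
  have h2 : `|\int[rho]_x transfer G f x - \sum_w weight rho (word n) w * transfer G f (extend w)|
      <= C' * th ^+ n.
    apply: (Rintegral_label_approx (phi := fun w => transfer G f (extend w)) rho th01 LfC) => //.
    by move=> x; apply: LfC; exact: agree_extend.
  have h3 : \sum_w weight rho (word n) w * transfer G f (extend w) =
      \sum_u q n u * f (scons u.1 (extend u.2)).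
    rewrite [RHS](eq_bigr (fun u => q n (u.1, u.2) * f (scons u.1 (extend u.2)))); last by case.
    rewrite -(pair_bigA _ (fun a w => q n (a, w) * f (scons a (extend w))))/= exchange_big/=.
    by apply: eq_bigr => w _; rewrite mulr_sumr; apply: eq_bigr => a _; rewrite mulrA.
  have h4 : `|\sum_u p n u * f (scons u.1 (extend u.2)) -
      \sum_u q n u * f (scons u.1 (extend u.2))| <= F * (K * th / t * th ^+ n + 2 * t).
    rewrite -sumrB; apply: (le_trans (ler_norm_sum _ _ _)).
    apply: (@le_trans _ _ (F * \sum_u `|p n u - q n u|)).
      rewrite mulr_sumr; apply: ler_sum => u _.
      by rewrite -mulrBl normrM mulrC ler_wpM2r.
    rewrite ler_wpM2l//.
    have := sum_dist_le_relative_entropy (weight_ge0 rho _) (@q_ge0 n) (p_sum n) (q_sum n) (@pq n) t0.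
    move=> /le_trans; apply; rewrite lerD2r mulrAC ler_pM2r ?invr_gt0//; exact: Dn.
  move: h2; rewrite h3 => h2.
  rewrite -(subrKA (\sum_u p n u * f (scons u.1 (extend u.2)))).
  apply: (le_trans (ler_normD _ _)).
  rewrite -[X in _ + `|X|](subrKA (\sum_u q n u * f (scons u.1 (extend u.2)))).
  apply: (le_trans (lerD h1 (ler_normD _ _))).
  rewrite [`|_ - \int[rho]_x transfer G f x|]distrC.
  apply: (le_trans (lerD (lexx _) (lerD h4 h2))).
  by rewrite exprS le_eqVlt; apply/orP; left; apply/eqP; ring.
apply/eqP; rewrite -subr_eq0 -normr_le0; apply/ler_addgt0Pr => e e0; rewrite add0r.
(* The Pinsker parameter: n tends to infinity with [t] fixed, leaving F 2 t <= e. [F + 1] keeps the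
   denominator positive. *)
pose t := e / (2 * (F + 1)).
have F1 : 0 < F + 1 by rewrite ltr_wpDl.
have t0 : 0 < t by rewrite divr_gt0// mulr_gt0.
apply: (@le_trans _ _ (0 + F * (2 * t))); last first.
  rewrite add0r /t (_ : F * _ = e * (F / (F + 1))); last by field; exact: lt0r_neq0.
  by rewrite ler_piMr ?(ltW e0)// ler_pdivrMr// mul1r lerDl.
have cv : (C * th + C' + F * (K * th / t)) * th ^+ n + F * (2 * t) @[n --> \oo] --> 0 + F * (2 * t).
  by apply: cvgD; [exact: cvg_th|exact: cvg_cst].
by apply: (ler_cvg_to (cvg_cst _) cv); apply: nearW => n; exact: bnd.
Qed.

End gibbs_inequality.

(** * Subdivision of an interval into consecutive pieces *)

Section digits.
Context {R : realType}.

Lemma digit_exists k (f : 'I_k -> R) v : (forall a, 0 <= f a) ->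
  0 <= v < \sum_a f a ->
  exists a : 'I_k, \sum_(b : 'I_k | (b < a)%N) f b <= v < \sum_(b : 'I_k | (b < a)%N) f b + f a.
Proof.
move=> f0 /andP[v0 vf].
pose P j := v < \sum_(b : 'I_k | (b < j)%N) f b.
have exP : exists j, P j.
  by exists k; rewrite /P (eq_bigl predT)// => b; rewrite ltn_ord.
case: (ex_minnP exP) => -[|j] Pj jmin.
  by move: Pj; rewrite /P big_pred0 ?ltNge ?v0.
have jk : (j < k)%N.
  by apply: jmin; rewrite /P (eq_bigl predT)// => b; rewrite ltn_ord.
exists (Ordinal jk); rewrite leNgt; apply/andP; split.
  by apply/negP => /jmin; rewrite ltnn.
move: Pj; rewrite /P (bigD1 (Ordinal jk))//= addrC.
rewrite (eq_bigl (fun b : 'I_k => (b < j)%N))// => b.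
by rewrite ltnS ltn_neqAle andbC.
Qed.

Lemma sum_ltn_le k (f : 'I_k -> R) (a a' : 'I_k) : (forall a, 0 <= f a) -> (a < a')%N ->
  \sum_(b : 'I_k | (b < a)%N) f b + f a <= \sum_(b : 'I_k | (b < a')%N) f b.
Proof.
move=> f0 aa'; rewrite [leRHS](bigD1 a)//= [leLHS]addrC lerD2l.
rewrite big_mkcond [leRHS]big_mkcond; apply: ler_sum => b _.
case: ltnP => [ba|_]; last by case: ifP.
by rewrite (ltn_trans ba aa')/= ifT// neq_ltn ba.
Qed.

Lemma sum_ltnD_le k (f : 'I_k -> R) (a : 'I_k) : (forall a, 0 <= f a) ->
  \sum_(b : 'I_k | (b < a)%N) f b + f a <= \sum_b f b.
Proof.
move=> f0; rewrite [leRHS](bigD1 a)//= [leLHS]addrC lerD2l.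
rewrite big_mkcond [leRHS]big_mkcond; apply: ler_sum => b _.
case: ltnP => [ba|_]; last by case: ifP.
by rewrite ifT// neq_ltn ba.
Qed.

End digits.

(* The measure with prescribed weights of cylinders is the image of the uniform
   measure by the map whose digits are read off nested subdivisions of [0, 1[
   into intervals of the prescribed lengths. *)
Section measure_of_cylinder_weights.
Context {R : realType} {d : nat}.
Local Notation Omega := (shift_space R d).
Variable m : seq 'I_d.+1 -> R.
Hypotheses (m0 : forall s, 0 <= m s) (m1 : m [::] = 1).
Hypothesis mS : forall s, \sum_a m (rcons s a) = m s.
Implicit Types (s : seq 'I_d.+1) (u : R).

(** Left endpoint of the interval of [s]: at each position, add the lengths of the siblings on the
    left. *)
Let l s : R := \sum_(k < size s) \sum_(b : 'I_d.+1 | (b < nth ord0 s k)%N) m (rcons (take k s) b).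

Let l_rcons s a : l (rcons s a) = l s + \sum_(b : 'I_d.+1 | (b < a)%N) m (rcons s b).
Proof.
rewrite /l size_rcons big_ord_recr/= nth_rcons ltnn eqxx.
rewrite -cats1 take_size_cat//; congr (_ + _); apply: eq_bigr => k _.
by rewrite nth_cat ltn_ord takel_cat// ltnW.
Qed.

Let I s : set R := [set` `[l s, l s + m s[%R].

Let IE s u : I s u <-> l s <= u < l s + m s.
Proof. by rewrite /I /= in_itv. Qed.

Let I_nil u : I [::] u <-> 0 <= u < 1.
Proof. by rewrite IE /l big_ord0 m1 add0r. Qed.

Let I_rcons s a : I (rcons s a) `<=` I s.
Proof.
move=> u /IE; rewrite l_rcons => /andP[lu um]; apply/IE/andP; split.
  by apply: le_trans lu; rewrite lerDl sumr_ge0.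
apply: (lt_le_trans um); rewrite -addrA lerD2l -[m s]mS.
exact: (sum_ltnD_le (f := fun b => m (rcons s b))).
Qed.

Let I_nil_sub s : I s `<=` I [::].
Proof. by elim/last_ind: s => // s a IHs; apply: subset_trans IHs; exact: I_rcons. Qed.

Let I_disjoint s a b u : I (rcons s a) u -> I (rcons s b) u -> a = b.
Proof.
wlog ab : a b / (a < b)%N => [wlg ua ub|].
  by have [?|?|/val_inj//] := ltngtP a b; [exact: wlg|apply/esym; exact: wlg].
move=> /IE /andP[_ ua] /IE /andP[ub _]; exfalso.
have := lt_le_trans ua (le_trans _ ub); rewrite ltxx => h; apply/negP: isT; apply: h.
rewrite !l_rcons -addrA lerD2l.
exact: (sum_ltn_le (f := fun b => m (rcons s b))).
Qed.

Let digit u s : 'I_d.+1 := odflt ord0 [pick a | u \in `[l (rcons s a), l (rcons s a) + m (rcons s a)[].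

Let I_digit s u : I s u -> I (rcons s (digit u s)) u.
Proof.
move=> /IE /andP[lu um]; rewrite /digit; case: pickP => [a//|noa]; exfalso.
have [] := @digit_exists R _ (fun a => m (rcons s a)) (u - l s) (fun a => m0 _).
  by rewrite subr_ge0 lu/= mS ltrBlDl.
move=> a; rewrite lerBrDl ltrBlDl addrA -l_rcons => h.
by have := noa a; rewrite in_itv/= h.
Qed.

Let Fixpoint prefix u n := if n is n'.+1 then rcons (prefix u n') (digit u (prefix u n')) else [::].

Let prefix_I u n : 0 <= u < 1 -> I (prefix u n) u.
Proof. by move=> u01; elim: n => [|n IHn]; [exact/I_nil|exact: I_digit]. Qed.

Let I_prefix u s : I s u -> prefix u (size s) = s.
Proof.
elim/last_ind: s => // s a IHs Isa; have Is := I_rcons Isa.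
rewrite size_rcons /= IHs//; congr rcons; apply: I_disjoint Isa; exact: I_digit.
Qed.

Let X u : Omega := if 0 <= u < 1 then fun n => digit u (prefix u n) else fun=> ord0.

Let X_prefix u n : 0 <= u < 1 -> mkseq (X u) n = prefix u n.
Proof. by move=> u01; elim: n => //= n IHn; rewrite mkseqS IHn /X u01. Qed.

Definition cylinder s : set Omega := [set x | mkseq x (size s) = s].

Lemma mkseq_agree n (x y : Omega) : mkseq x n = mkseq y n <-> agree n x y.
Proof.
split => [xy i ni|xy]; last by apply/eq_in_map => i; rewrite mem_iota => /xy.
by rewrite -(nth_mkseq ord0 x ni) xy nth_mkseq.
Qed.

Lemma cylinder_depends_on s : depends_on (size s) (cylinder s).
Proof. by move=> x y /mkseq_agree xy; rewrite /cylinder/= -xy. Qed.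

(** Points outside [0, 1[ all go to the constant sequence [ord0]; the second set accounts for them
    and is null for the uniform law. *)
Let X_cylinder s : X @^-1` cylinder s =
  I s `|` (if `[< cylinder s (fun=> ord0) >] then ~` I [::] else set0).
Proof.
apply/seteqP; split => u /=; rewrite /cylinder/=.
  have [u01|u01] := boolP (0 <= u < 1).
    by rewrite X_prefix// => us; left; have := prefix_I (size s) u01; rewrite us.
  rewrite /X (negbTE u01) => us; right; rewrite ifT; last exact/asboolP.
  by move=> /I_nil; apply/negP.
case=> [Is|]; first by rewrite X_prefix ?I_prefix//; apply (I_nil u).1; exact: I_nil_sub Is.
case: ifPn => // /asboolP ps nI; rewrite /X ifF//.
by apply/negP => /I_nil.
Qed.

Lemma word_cylinder n (w : {ffun 'I_n -> 'I_d.+1}) :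
  (word n : Omega -> _) @^-1` [set w] = cylinder (mkseq (extend w : Omega) n).
Proof.
apply/seteqP; split => x; rewrite /cylinder/= size_mkseq.
  by move=> <-; apply/mkseq_agree; exact: agree_extend.
by move=> /mkseq_agree/wordP ->; rewrite word_extend.
Qed.

Let measurable_X : measurable_fun [set: measurableTypeR R] X.
Proof.
move=> _ U mU; rewrite setTI; move: U mU.
rewrite measurable_clopen_sets; apply: smallest_sub; first split.
- by rewrite /= preimage_set0.
- by move=> U mU /=; rewrite setTD -preimage_setC; exact: measurableC.
- by move=> U mU /=; rewrite preimage_bigcup; exact: bigcup_measurable.
move=> U [n nU] /=.
rewrite (depends_onE nU) (_ : _ @^-1` _ = \bigcup_(w in word n @` U) X @^-1` (word n @^-1` [set w])).
  apply: fin_bigcup_measurable => // w _.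
  rewrite word_cylinder X_cylinder; apply: measurableU; first exact: measurable_itv.
  by case: ifP => // _; apply: measurableC; exact: measurable_itv.
apply/seteqP; split => u /=; first by move=> Pu; exists (word n (X u)).
by move=> [w Pw /= ->].
Qed.

Lemma measure_of_cylinder_weights : exists mu : probability Omega R,
  forall s, mu (cylinder s) = (m s)%:E.
Proof.
pose Xm := @isMeasurableFun.Build _ _ (measurableTypeR R) Omega X measurable_X.
pose XX : {mfun measurableTypeR R >-> Omega} := HB.pack (X : measurableTypeR R -> Omega) Xm.
pose P := uniform_prob (@ltr01 R) : probability (measurableTypeR R) R.
have mI s : measurable (I s : set (measurableTypeR R)) by exact: measurable_itv.
have PI s : P (I s) = (m s)%:E.
  rewrite /P/= /uniform_prob integral_uniform_pdf.
  have I01 u : I s u -> 0 <= u <= 1.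
    by move=> /I_nil_sub /I_nil /andP[-> /ltW].
  rewrite (_ : I s `&` _ = I s); last first.
    by apply/seteqP; split => [u []//|u Iu]; split => //=; rewrite in_itv/= I01.
  rewrite (eq_integral (fun=> 1%:E)); last first.
    by move=> u; rewrite inE => /I01 u01; rewrite /uniform_pdf u01 subr0 invr1.
  rewrite integral_cst//= mul1e /I lebesgue_measure_itv/= lte_fin ltrDl.
  case: ltP => [_|ms]; first by rewrite -EFinB addrAC subrr add0r.
  by congr (_%:E); apply/eqP; rewrite eq_le m0 ms.
exists (distribution P XX) => s.
rewrite /distribution/= /pushforward X_cylinder measureU//; first last.
- case: ifP => _; last by rewrite setI0.
  by apply/seteqP; split => // u [/I_nil_sub].
- by case: ifP => // _; apply: measurableC.
set Z := if _ then _ else _; have PZ : P Z = 0%E.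
  rewrite /Z; case: ifP => _; last by rewrite measure0.
  by rewrite probability_setC// PI m1 subee.
have h : (P (I s) + P Z = (m s)%:E)%E by rewrite PI PZ adde0.
exact: h.
Qed.

End measure_of_cylinder_weights.

Lemma cvgn_unique {R : realType} (u : R^nat) (a b : R) :
  u @ \oo --> a -> u @ \oo --> b -> a = b.
Proof.
by move=> ua ub; rewrite -(cvg_lim (@Rhausdorff R) ua) (cvg_lim (@Rhausdorff R) ub).
Qed.

Lemma eq_indic {T : Type} {R : pzRingType} (A B : set T) (x y : T) :
  (A x <-> B y) -> \1_A x = \1_B y :> R.
Proof.
move=> AB; rewrite !indicE; congr (nat_of_bool _)%:R.
by apply/idP/idP => /set_mem ?; apply/mem_set/AB.
Qed.

(** * The measure fixed by the dual operator *)

Section gibbs_measure.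
Context {R : realType} {d : nat}.
Local Notation Omega := (shift_space R d).
Variables (th K : R) (G : Omega -> R).
Hypotheses (th01 : 0 < th < 1) (GK : has_variation th K G).
Hypothesis G1 : forall x, \sum_a expR (G (scons a x)) = 1.
Implicit Types (f : Omega -> R) (s : seq 'I_d.+1).

Let th0 : 0 < th. Proof. by case/andP: th01. Qed.

Let ind s : Omega -> R := \1_(cylinder s).

(** The indicator can only change when n < size s, and then the bound is at least 1. *)
Lemma cylinder_variation s : has_variation th (th ^- size s) (ind s).
Proof.
move=> n x y xy; have [sn|ns] := leqP (size s) n.
  have xy' := agree_le sn xy.
  rewrite /ind (@eq_indic _ _ _ (cylinder s) x y) ?subrr ?normr0.
    by rewrite mulr_ge0 ?invr_ge0 ?exprn_ge0 ?(ltW th0).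
  by split; apply: cylinder_depends_on => //; exact: agree_sym.
apply: (@le_trans _ _ 1).
  by rewrite /ind !indicE; do 2 case: (_ \in _); rewrite ?subrr ?subr0 ?sub0r ?normrN ?normr1 ?normr0.
rewrite mulrC -(subnKC (ltnW ns)) exprD invfM mulrA divff ?mul1r ?expf_neq0 ?gt_eqF//.
by rewrite invf_ge1 ?exprn_gt0// exprn_ile1 ?(ltW th0)//; case/andP: th01 => _ /ltW.
Qed.

(** The constant limit of the iterates on the indicator of the cylinder, to become its weight. *)
Let m s : R := projT1 (cid (iter_transfer_cvg th01 GK G1 (cylinder_variation s))).

Let m_unif s (e : R) : 0 < e -> exists k0, forall k x, (k0 <= k)%N ->
  `|iter k (transfer G) (ind s) x - m s| <= e.
Proof. by rewrite /m; case: cid => c /= h; exact: h. Qed.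
Arguments m_unif : clear implicits.

Let m_cvg s : iter k (transfer G) (ind s) point @[k --> \oo] --> m s.
Proof.
apply/cvgrPdist_le => e /(m_unif s)[k0 h]; exists k0 => // k /= k0k.
by rewrite distrC h.
Qed.
Arguments m_cvg : clear implicits.

Let m_cvg_transfer s : iter k (transfer G) (transfer G (ind s)) point @[k --> \oo] --> m s.
Proof.
have h := m_cvg s; rewrite -(cvg_shiftS (fun k => iter k (transfer G) (ind s) point)) in h.
rewrite (_ : (fun k => _) = (fun k => iter k.+1 (transfer G) (ind s) point))//.
by apply/funext => k; rewrite iterSr.
Qed.
Arguments m_cvg_transfer : clear implicits.

Let m_ge0 s : 0 <= m s.
Proof.
apply: (ler_cvg_to (cvg_cst 0) (m_cvg s)); apply: nearW => k.
rewrite -[leLHS](iter_transfer_cst G1 k 0 point); apply: iter_transfer_le => x.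
by rewrite /ind indicE.
Qed.

Let m_nil : m [::] = 1.
Proof.
have : (fun k => iter k (transfer G) (ind [::]) point) = fun=> 1.
  apply/funext => k; rewrite (_ : ind _ = fun=> 1) ?(iter_transfer_cst G1)//.
  by apply/funext => x; rewrite /ind indicE mem_set.
move=> h; have := m_cvg [::]; rewrite h => h'.
by apply: (cvgn_unique h'); exact: cvg_cst.
Qed.

Let iter_transfer_sum k (I : finType) (f : I -> Omega -> R) :
  iter k (transfer G) (fun x => \sum_i f i x) =
  (fun x => \sum_i iter k (transfer G) (f i) x).
Proof.
elim: k => //= k ->; apply/funext => x; rewrite /transfer.
by rewrite exchange_big/=; apply: eq_bigr => a _; rewrite mulr_sumr.
Qed.

Let cvg_sum (I : finType) (u : I -> nat -> R) (l : I -> R) :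
  (forall i, u i k @[k --> \oo] --> l i) -> \sum_i u i k @[k --> \oo] --> \sum_i l i.
Proof. by move=> ul; apply: cvg_big => [|i _]; [exact: add_continuous|exact: ul]. Qed.

Let cylinder_rcons s a (x : Omega) : cylinder (rcons s a) x <-> cylinder s x /\ x (size s) = a.
Proof.
rewrite /cylinder/= size_rcons mkseqS; split => [/rcons_inj[]//|[-> ->]//].
Qed.

Let cylinder_cons s a (x : Omega) : cylinder (a :: s) x <-> x 0%N = a /\ cylinder s (shift_map x).
Proof.
rewrite /cylinder/= /mkseq /= -[1%N]/(1 + 0)%N iotaDl -map_comp.
by split => [[-> {2}<-]//|[-> {2}<-]].
Qed.

Let m_rcons s : \sum_a m (rcons s a) = m s.
Proof.
have h : \sum_a iter k (transfer G) (ind (rcons s a)) point @[k --> \oo] --> \sum_a m (rcons s a).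
  by apply: cvg_sum => a; exact: m_cvg.
have h' : (fun k => \sum_a iter k (transfer G) (ind (rcons s a)) point) =
   (fun k => iter k (transfer G) (ind s) point).
  apply/funext => k; rewrite -[LHS](congr1 (@^~ point) (iter_transfer_sum k (fun a => ind (rcons s a)))).
  congr (iter k _ _ _); apply/funext => x; rewrite /ind.
  rewrite (bigD1 (x (size s)))//= big1 ?addr0.
    by apply: eq_indic; split => [/cylinder_rcons[]|?]//; apply/cylinder_rcons.
  by move=> a ax; rewrite indicE memNset// => /cylinder_rcons[_ xa]; rewrite xa eqxx in ax.
by rewrite h' in h; exact: cvgn_unique h (m_cvg s).
Qed.

Let transfer_ind a s x : transfer G (ind (a :: s)) x = expR (G (scons a x)) * ind s x.
Proof.
rewrite /transfer (bigD1 a)//= big1 ?addr0.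
  congr (_ * _); apply: eq_indic.
  by split => [/cylinder_cons[]//|?]; apply/cylinder_cons.
move=> b ba; rewrite /ind indicE memNset ?mulr0// => /cylinder_cons[/= ab _].
by rewrite ab eqxx in ba.
Qed.

(** The source of shift-invariance: the indicators of the cylinders [a :: s] have images under
    [transfer G] that sum to the indicator of [s], by [G1]. *)
Let m_cons_sum s : \sum_a m (a :: s) = m s.
Proof.
have h : \sum_a iter k (transfer G) (transfer G (ind (a :: s))) point @[k --> \oo] -->
    \sum_a m (a :: s).
  by apply: cvg_sum => a; exact: m_cvg_transfer.
have h' : (fun k => \sum_a iter k (transfer G) (transfer G (ind (a :: s))) point) =
   (fun k => iter k (transfer G) (ind s) point).
  apply/funext => k.
  rewrite -[LHS](congr1 (@^~ point) (iter_transfer_sum k (fun a => transfer G (ind (a :: s))))).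
  congr (iter k _ _ _); apply/funext => x; under eq_bigr do rewrite transfer_ind.
  by rewrite -mulr_suml G1 mul1r.
by rewrite h' in h; exact: cvgn_unique h (m_cvg s).
Qed.

(** Over the cylinder [s], G after prepending [a] varies by at most K th^(n+1), n = size s. This
    one-sided Gibbs bound makes the relative entropies tend to 0. *)
Let m_cons_le a s y : cylinder s y ->
  m (a :: s) <= expR (G (scons a y) + K * th ^+ (size s).+1) * m s.
Proof.
move=> sy; set c := expR _.
have hc : c * iter k (transfer G) (ind s) point @[k --> \oo] --> c * m s.
  by apply: cvgM; [exact: cvg_cst|exact: m_cvg].
apply: (ler_cvg_to (m_cvg_transfer (a :: s)) hc); apply: nearW => k.
rewrite -[leRHS](congr1 (@^~ point) (iter_transferZ G k c (ind s))).
apply: iter_transfer_le => x; rewrite transfer_ind.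
have [sx|sx] := pselect (cylinder s x); last first.
  by rewrite /ind indicE memNset// !mulr0.
rewrite /ind indicE mem_set// !mulr1 /c ler_expR addrC -lerBlDr.
apply: le_trans (ler_norm _) (GK _); apply: agree_scons.
by apply/mkseq_agree; rewrite sx sy.
Qed.

Let measurable_cylinder s : measurable (cylinder s : set Omega).
Proof. exact: measurable_depends_on (@cylinder_depends_on R d s). Qed.

(** The image of [mu] under the shift is a probability, so [probability_word_unique] compares it
    with [mu]. *)
Lemma shift_invariantP (mu : probability Omega R) :
  (forall s, mu (shift_map @^-1` cylinder s) = mu (cylinder s)) -> shift_invariant mu.
Proof.
move=> h; have mT : measurable_fun [set: Omega] (shift_map : Omega -> Omega).
  by move=> _ U mU; rewrite setTI; exact: measurable_shift_map.
pose Tm := @isMeasurableFun.Build _ _ Omega Omega shift_map mT.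
pose T : {mfun Omega >-> Omega} := HB.pack (shift_map : Omega -> Omega) Tm.
move=> U mU; apply: (probability_word_unique (mu := distribution mu T) (nu := mu)) => //.
by move=> n w; rewrite word_cylinder; exact: h.
Qed.

Lemma gibbs_measure : exists mu : probability Omega R, [/\ shift_invariant mu,
  entropy_of_partition mu shift_map letter + \int[mu]_x G x = 0 &
  forall rho : probability Omega R, shift_invariant rho ->
    entropy_of_partition rho shift_map letter + \int[rho]_x G x = 0 ->
    forall U, measurable U -> rho U = mu U].
Proof.
have [mu hmu] := measure_of_cylinder_weights m_ge0 m_nil m_rcons.
have muT : shift_invariant mu.
  apply: shift_invariantP => s.
  have ml : measurable_partition (letter : Omega -> _) by exact: measurable_partition_letter.
  have mTs : measurable (shift_map @^-1` cylinder s : set Omega) by exact: measurable_shift_map.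
  have := fine_probability_label mu predT ml mTs.
  rewrite (_ : letter @^-1` _ = setT) ?setIT; last by apply/seteqP; split.
  move=> h; rewrite hmu -m_cons_sum -(fineK (fin_num_measure mu _ mTs)) h.
  congr (_%:E); apply: eq_bigr => a _.
  rewrite -[RHS]/(fine (m (a :: s))%:E) -hmu; congr (fine (mu _)).
  by apply/seteqP; split => x /=; [move=> [sx xa]; apply/cylinder_cons|move=> /cylinder_cons[]].
exists mu; split => //.
  apply: (gibbs_equality th01 GK G1 muT) => e e0.
  have /cvgrPdist_le /(_ _ e0)[n0 _ hn0] : K * th * th ^+ n @[n --> \oo] --> 0.
    rewrite -(mulr0 (K * th)); apply: cvgM; first exact: cvg_cst.
    by apply: cvg_expr; rewrite gtr0_norm//; case/andP: th01.
  exists n0 => n /hn0; rewrite sub0r normrN => /(le_trans (ler_norm _)); apply: le_trans.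
  have mlw : measurable_partition (letter_word n : Omega -> _) by exact: measurable_letter_word.
  (* Each logarithm ln p - ln q is at most K th^(n+1) by [m_cons_le], and the weights p sum to 1. *)
  rewrite /relative_entropy -[leRHS]mul1r -(sum_weight mu mlw) mulr_suml.
  apply: ler_sum => -[a w] _ /=; set p := weight mu _ _.
  set s := mkseq (extend w : Omega) n.
  have pE : p = m (a :: s).
    rewrite -[RHS]/(fine (m (a :: s))%:E) -hmu /p /weight; congr (fine (mu _)).
    apply/seteqP; split => x.
      move=> [xa xw]; apply/cylinder_cons; split => //.
      by rewrite -word_cylinder.
    by move=> /cylinder_cons[xa]; rewrite -word_cylinder => xw; congr pair.
  have rE : weight mu (word n) w = m s by rewrite /weight word_cylinder hmu.
  rewrite rE.
  have [p0|p0] := eqVneq p 0; first by rewrite p0 !mul0r.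
  have pgt0 : 0 < p by rewrite lt0r p0 weight_ge0.
  have ws : cylinder s (extend w : Omega) by rewrite /cylinder/= size_mkseq.
  have := m_cons_le a ws; rewrite -pE size_mkseq => hp.
  have r0 : 0 < m s.
    by have := lt_le_trans pgt0 hp; rewrite pmulr_rgt0 ?expR_gt0.
  rewrite ler_pM2l// lerBlDr lnM ?posrE ?expR_gt0// expRK.
  have : ln p <= ln (expR (G (scons a (extend w)) + K * th ^+ n.+1) * m s).
    by rewrite ler_ln ?posrE ?mulr_gt0 ?expR_gt0.
  by rewrite lnM ?posrE ?expR_gt0// expRK exprS mulrA; lra.
move=> rho rhoT hrho; apply: probability_word_unique => n w; rewrite word_cylinder.
set s := mkseq _ _; rewrite hmu.
have ms : measurable (cylinder s : set Omega) by exact: measurable_cylinder.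
rewrite -(fineK (fin_num_measure rho _ ms)); congr (_%:E).
have <- : \int[rho]_x ind s x = fine (rho (cylinder s)).
  by rewrite /Rintegral /ind integral_indic// setIT.
have [C hC] := iter_transfer_variation th01 GK G1 (cylinder_variation s).
have intE k : \int[rho]_x ind s x = \int[rho]_x iter k (transfer G) (ind s) x.
  elim: k => // k ->; rewrite [in RHS]/=.
  apply: (gibbs_transfer th01 GK G1 rhoT hrho (hC k)).
  by exists C; exact: (hC k.+1).
apply/eqP; rewrite -subr_eq0 -normr_le0; apply/ler_addgt0Pr => e e0; rewrite add0r.
have [k hk] := m_unif s _ e0.
(* With the one-cell partition, [Rintegral_label_approx] says that a function within e of a constant
   has its integral within e of it. *)
have mtt : measurable_partition (fun _ : Omega => tt).
  by move=> i; rewrite preimage_cst; case: ifP.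
rewrite (intE k).
have := Rintegral_label_approx rho (phi := fun=> m s) th01 (hC k) mtt (fun x => hk k x (leqnn k)).
by rewrite -mulr_suml (sum_weight rho mtt) mul1r.
Qed.

End gibbs_measure.

(** * Existence and uniqueness of equilibrium states *)

Section equilibrium.
Context {R : realType} {d : nat}.
Local Notation Omega := (shift_space R d).
Implicit Types (B : Omega -> R) (rho : probability Omega R).

Lemma variation_shift th C (f : Omega -> R) : 0 < th < 1 -> has_variation th C f ->
  has_variation th (C / th) (f \o shift_map).
Proof.
move=> /andP[th0 th1] fC [|n] x y xy /=.
  have C0 : 0 <= C := le_trans (normr_ge0 _) (variation_osc point point fC).
  rewrite expr0 mulr1; apply: (le_trans (variation_osc _ _ fC)).
  by rewrite ler_pdivlMr// ler_piMr// ltW.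
rewrite exprS mulrA divfK ?gt_eqF//; apply: fC => i ni.
exact: xy.
Qed.

Lemma variationD th C C' (f g : Omega -> R) : has_variation th C f ->
  has_variation th C' g -> has_variation th (C + C') (fun x => f x + g x).
Proof.
move=> fC gC n x y xy; rewrite opprD addrACA mulrDl.
by apply: (le_trans (ler_normD _ _)); rewrite lerD ?fC ?gC.
Qed.

Lemma variationN th C (f : Omega -> R) : has_variation th C f ->
  has_variation th C (fun x => - f x).
Proof. by move=> fC n x y xy; rewrite -opprD normrN fC. Qed.

(** Both integrals are approximated by the same finite sum, since the words of x and of its shift
    have the same law. *)
Lemma Rintegral_shift th C (f : Omega -> R) rho : 0 < th < 1 -> has_variation th C f ->
  shift_invariant rho -> \int[rho]_x f (shift_map x) = \int[rho]_x f x.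
Proof.
move=> th01 fC rhoT; have fTC := variation_shift th01 fC.
have /andP[th0 th1] := th01.
have mw n : measurable_partition (word n : Omega -> _) by exact: measurable_partition_word.
have mwT n : measurable_partition (word n \o shift_map : Omega -> _).
  exact: (measurable_partition_map (@measurable_shift_map R d)).
apply/eqP; rewrite -subr_eq0 -normr_le0.
have cv : C * th ^+ n + C * th ^+ n @[n --> \oo] --> (0 + 0 : R).
  rewrite -(mulr0 C); apply: cvgD; (apply: cvgM; first exact: cvg_cst);
  by apply: cvg_expr; rewrite gtr0_norm.
rewrite addr0 in cv; apply: (ler_cvg_to (cvg_cst _) cv); apply: nearW => n.
have h1 : `|\int[rho]_x f x - \sum_w weight rho (word n) w * f (extend w)| <= C * th ^+ n.
  apply: (Rintegral_label_approx (phi := fun w => f (extend w)) rho th01 fC) => //.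
  by move=> x; apply: fC; exact: agree_extend.
have h2 : `|\int[rho]_x f (shift_map x) - \sum_w weight rho (word n \o shift_map) w * f (extend w)| <= C * th ^+ n.
  apply: (Rintegral_label_approx (phi := fun w => f (extend w)) rho th01 fTC) => //.
  by move=> x; apply: fC; exact: agree_extend.
have h3 : \sum_w weight rho (word n \o shift_map) w * f (extend w) =
   \sum_w weight rho (word n) w * f (extend w).
  by apply: eq_bigr => w _; rewrite /weight comp_preimage rhoT//; exact: mw.
rewrite h3 in h2.
rewrite -(subrKA (\sum_w weight rho (word n) w * f (extend w))).
by apply: (le_trans (ler_normD _ _)); rewrite lerD// distrC.
Qed.

Lemma hoelder_integrable B rho : hoelder_potential B -> rho.-integrable setT (EFin \o B).
Proof. by move=> /hoelder_variation[th [C [th01 _ BC]]]; exact: variation_integrable th01 BC. Qed.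

(** The constant [l] is the pressure: coboundaries integrate to 0, so rho (B) + h (rho) = l + (h
    (rho) + rho (G)), whose bracket is nonpositive and vanishes for exactly one invariant
    measure. *)
Lemma hoelder_equilibrium B : hoelder_potential B ->
  (exists p : R, pressure B = p%:E) /\
  exists mu : probability Omega R, unique_linear_equilibrium B mu.
Proof.
move=> /hoelder_variation[th [K [th01 K0 BK]]].
have [f [l [fD G1]]] := eigenfunction th01 BK.
pose G x := B x + f x - f (shift_map x) - l.
have intG rho : shift_invariant rho -> \int[rho]_x G x = \int[rho]_x B x - l.
  move=> rhoT.
  have iB := variation_integrable rho th01 BK.
  have if' := variation_integrable rho th01 fD.
  have ifT := variation_integrable rho th01 (variation_shift th01 fD).
  have icst : rho.-integrable setT (EFin \o cst l) by exact: finite_measure_integrable_cst.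
  rewrite /G RintegralB//; last exact: (integrableB measurableT (integrableD measurableT iB if') ifT).
  rewrite RintegralB//; last exact: (integrableD measurableT iB if').
  rewrite RintegralD// (Rintegral_shift th01 fD rhoT) addrK; congr (_ - _).
  rewrite Rintegral_cst// (_ : fine _ = 1) ?mulr1//.
  by rewrite (_ : _ setT = 1%E)//; exact: probability_setT.
have [K' GK] : exists K', has_variation th K' G.
  have vl : has_variation th 0 (fun _ : Omega => l).
    by move=> n x y _; rewrite subrr normr0 mul0r.
  eexists; exact: (variationD (variationD (variationD BK fD)
    (variationN (variation_shift th01 fD))) (variationN vl)).
(* [shift_map (scons a x)] is convertible to [x]. *)
have G1' x : \sum_a expR (G (scons a x)) = 1 by exact: G1.
have [mu [muT hmu muU]] := gibbs_measure th01 GK G1'.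
have ksE rho : shift_invariant rho ->
  ((\int[rho]_x B x)%:E + ks_entropy rho shift_map =
   (l + (entropy_of_partition rho shift_map letter + \int[rho]_x G x))%:E)%E.
  by move=> rhoT; rewrite ks_entropy_shift// -EFinD intG//; congr (_%:E); ring.
have pE : pressure B = l%:E.
  apply/eqP; rewrite eq_le; apply/andP; split.
    apply: ge_ereal_sup => _ [rho /= rhoT <-]; rewrite ksE// lee_fin gerDl.
    exact: (gibbs_inequality th01 GK G1' rhoT).
  by apply: ereal_sup_ubound; exists mu => //; rewrite ksE// hmu addr0.
split; first by exists l.
exists mu; split; first by split => //; rewrite pE ksE// hmu addr0.
move=> rho [rhoT]; rewrite pE ksE// => -[h]; apply: muU => //.
by apply: (addrI l); rewrite addr0.
Qed.

End equilibrium.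

(** * Convex duality *)

Section convex_functions.
Context {R : realType}.
Variable F : R -> R.
Hypothesis hF : convex_function (E := R^o) setT F.

Lemma convex_three_points y x z : y < x -> x < z ->
  (z - y) * F x <= (z - x) * F y + (x - y) * F z.
Proof.
move=> yx xz; have yz : 0 < z - y by rewrite subr_gt0 (lt_trans yx).
have t0 : 0 <= (z - x) / (z - y) by rewrite divr_ge0 ?(ltW yz)// subr_ge0 ltW.
have t1 : (z - x) / (z - y) <= 1 by rewrite ler_pdivrMr// mul1r lerD2l lerN2 ltW.
have : F ((z - x) / (z - y) * y + (1 - (z - x) / (z - y)) * z) <=
    (z - x) / (z - y) * F y + (1 - (z - x) / (z - y)) * F z.
  exact: (hF (Itv01 t0 t1) (in_setT y) (in_setT z)).
have -> : (z - x) / (z - y) * y + (1 - (z - x) / (z - y)) * z = x.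
  by field; exact: lt0r_neq0.
move=> h; have : (z - y) * F x <= (z - y) * ((z - x) / (z - y) * F y + (1 - (z - x) / (z - y)) * F z).
  by rewrite ler_pM2l.
move=> /le_trans; apply; rewrite le_eqVlt; apply/orP; left; apply/eqP.
by field; exact: lt0r_neq0.
Qed.

(** Take the supremum of the slopes on the left of [x]; every slope on the right bounds it. *)
Lemma subgradient_exists x : exists s, forall y, F x + s * (y - x) <= F y.
Proof.
pose S := [set (F x - F y) / (x - y) | y in [set y | y < x]].
have slope y z : y < x -> x < z -> (F x - F y) / (x - y) <= (F z - F x) / (z - x).
  move=> yx xz; have := convex_three_points yx xz => h.
  rewrite ler_pdivrMr ?subr_gt0// mulrAC ler_pdivlMr ?subr_gt0//; lra.
have S0 : S !=set0 by exists ((F x - F (x - 1)) / (x - (x - 1))), (x - 1) => //=; rewrite ltrBlDr ltrDl.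
have Sub : has_ubound S.
  by exists ((F (x + 1) - F x) / (x + 1 - x)) => _ [y /= yx <-]; apply: slope => //; rewrite ltrDl.
exists (sup S) => y; have [yx|xy|->] := ltgtP y x; last by rewrite subrr mulr0 addr0.
  have : (F x - F y) / (x - y) <= sup S by apply: ub_le_sup => //; exists y.
  by rewrite ler_pdivrMr ?subr_gt0//; lra.
have : sup S <= (F y - F x) / (y - x) by apply: ge_sup => // _ [z /= zx <-]; exact: slope.
by rewrite ler_pdivlMr ?subr_gt0//; lra.
Qed.

Lemma legendre_ge s x : ((s * x - F x)%:E <= legendre F s)%E.
Proof. by apply: ereal_sup_ubound; exists x. Qed.

Lemma legendre_subgradient s x : (forall y, F x + s * (y - x) <= F y) ->
  legendre F s = (s * x - F x)%:E.
Proof.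
move=> sF; apply/eqP; rewrite eq_le legendre_ge andbT.
apply: ge_ereal_sup => _ [y _ <-]; rewrite lee_fin; have := sF y; lra.
Qed.

Lemma biconjugate x :
  ereal_sup [set ((s * x)%:E - legendre F s)%E | s in [set: R]] = (F x)%:E.
Proof.
apply/eqP; rewrite eq_le; apply/andP; split.
  apply: ge_ereal_sup => _ [s _ <-].
  have := legendre_ge s x; case: (legendre F s) => [r| |]//=.
    by rewrite -EFinB !lee_fin; lra.
  by rewrite leNye.
have [s hs] := subgradient_exists x.
apply: ereal_sup_ubound; exists s => //.
by rewrite (legendre_subgradient hs) -EFinB; congr (_%:E); ring.
Qed.

End convex_functions.

(** * Differentiability by squeezing *)

Section squeeze.
Context {R : realType}.
Variables (f g : R -> R) (x a : R).
Hypothesis fg : forall t, (t - x) * a <= f t - f x <= g t - g x.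
Hypothesis dg : derivable g x 1.

Let quot (u : R -> R) (h : R) := h^-1 *: ((u \o shift x) (h *: 1) - u x).

Let quotE u h : quot u h = (u (h + x) - u x) / h.
Proof. by rewrite /quot/= /GRing.scale/= mulr1 mulrC. Qed.

Let quot_cvg : quot g h @[h --> 0^'] --> 'D_1 g x.
Proof. exact: dg. Qed.

Let quot_pos h : 0 < h -> a <= quot f h <= quot g h.
Proof.
move=> h0; rewrite !quotE ler_pdivlMr// ler_pM2r ?invr_gt0//.
by have := fg (h + x); rewrite addrK mulrC.
Qed.

Let quot_neg h : h < 0 -> quot g h <= quot f h <= a.
Proof.
move=> h0; have /andP := fg (h + x); rewrite addrK mulrC => -[fa gf].
by rewrite !quotE ler_nM2r ?invr_lt0// gf ler_ndivrMr.
Qed.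

(** The difference quotients of g are at least [a] on the right of x and at most [a] on the left. *)
Lemma squeezed_derive : 'D_1 g x = a.
Proof.
apply/eqP; rewrite -subr_eq0 -normr_le0; apply/ler_addgt0Pr => e e0; rewrite add0r.
have /cvgrPdist_lt /(_ _ e0) := quot_cvg.
move=> /nbhs_ballP[r /= r0 hr].
have r2 : 0 < r / 2 by rewrite divr_gt0.
have rr : r / 2 < r by rewrite ltr_pdivrMr// ltr_pMr// ltr1n.
have h1 : `|'D_1 g x - quot g (r / 2)| < e.
  by apply: hr; rewrite ?gt_eqF// /ball/= sub0r normrN gtr0_norm.
have h2 : `|'D_1 g x - quot g (- (r / 2))| < e.
  by apply: hr; rewrite ?oppr_eq0 ?gt_eqF// /ball/= sub0r normrN normrN gtr0_norm.
have := quot_pos r2 => /andP[h3 h4].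
have := @quot_neg (- (r / 2)); rewrite oppr_lt0 => /(_ r2) /andP[h5 h6].
move: h1 h2; rewrite !ltr_norml ler_norml; lra.
Qed.

Lemma squeezed_is_derive : is_derive x 1 f a.
Proof.
have cv : quot f h @[h --> 0^'] --> a.
  have cv' := quot_cvg; rewrite squeezed_derive in cv'.
  apply/cvgrPdist_lt => e e0; have /cvgrPdist_lt /(_ _ e0) := cv'.
  move=> /nbhs_ballP[r /= r0 hr]; apply/nbhs_ballP; exists r => //= h hh h0.
  have := hr h hh h0; have [hneg|hpos|/eqP] := ltgtP h 0; last by rewrite (negbTE h0).
    have /andP[h1 h2] := quot_neg hneg; rewrite !ltr_norml; lra.
  have /andP[h1 h2] := quot_pos hpos; rewrite !ltr_norml; lra.
split; first by apply/cvg_ex; exists a.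
by apply: (cvg_lim (@Rhausdorff R)); exact: cv.
Qed.

End squeeze.

(** * Linear and nonlinear equilibria *)

Section nonlinear_equilibria.
Context {R : realType} {d : nat}.
Local Notation Omega := (shift_space R d).
Variable A : Omega -> R.
Hypothesis hA : hoelder_potential A.
Implicit Types (rho : probability Omega R) (s t : R).

Local Notation h rho := (entropy_of_partition rho shift_map letter).
Local Notation a rho := (\int[rho]_x A x).

Lemma hoelder_potentialZ s : hoelder_potential (fun x => s * A x).
Proof.
have [al [C [al01 C0 AC]]] := hA; exists al, (`|s| * C); split => //.
  exact: mulr_ge0.
by move=> x y; rewrite -mulrBr normrM -mulrA ler_wpM2l.
Qed.

Lemma RintegralZA rho s : \int[rho]_x (s * A x) = s * a rho.
Proof. by apply: RintegralZl => //; exact: hoelder_integrable. Qed.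

Lemma pressureE s : pressure (fun x => s * A x) = (pressure_fun A s)%:E.
Proof.
have [[p hp] _] := hoelder_equilibrium (hoelder_potentialZ s).
by rewrite /pressure_fun hp.
Qed.

Lemma pressure_ge s rho : shift_invariant rho -> s * a rho + h rho <= pressure_fun A s.
Proof.
move=> rhoT; rewrite -lee_fin -pressureE; apply: ereal_sup_ubound.
by exists rho => //; rewrite RintegralZA ks_entropy_shift.
Qed.

Lemma linear_equilibriumP s rho : linear_equilibrium (fun x => s * A x) rho <->
  shift_invariant rho /\ s * a rho + h rho = pressure_fun A s.
Proof.
split => -[rhoT e]; split => //; move: e; rewrite RintegralZA ks_entropy_shift// pressureE.
  by case.
by move=> <-.
Qed.

Lemma linear_equilibrium_unique s rho : linear_equilibrium (fun x => s * A x) rho ->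
  unique_linear_equilibrium (fun x => s * A x) rho.
Proof.
move=> rhoE; split=> // rho' rho'E U mU.
have [_ [mu [_ muU]]] := hoelder_equilibrium (hoelder_potentialZ s).
by rewrite (muU _ rhoE _ mU) (muU _ rho'E _ mU).
Qed.

Lemma nonlinear_equilibriumP (F : R -> R) rho : nonlinear_equilibrium A F rho <->
  shift_invariant rho /\ forall rho', shift_invariant rho' ->
    F (a rho') + h rho' <= F (a rho) + h rho.
Proof.
split => -[rhoT hrho]; split => //.
  move=> rho' rho'T; rewrite -lee_fin !EFinD -!ks_entropy_shift// hrho.
  by apply: ereal_sup_ubound; exists rho'.
apply/eqP; rewrite eq_le; apply/andP; split.
  by apply: ereal_sup_ubound; exists rho.
apply: ge_ereal_sup => _ [rho' /= rho'T <-].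
by rewrite !ks_entropy_shift// -!EFinD lee_fin hrho.
Qed.

Variable F : R -> R.
Hypothesis hF : convex_function (E := R^o) setT F.

Lemma fenchel_young s x : legendre F s \is a fin_num ->
  s * x - legendre_fun F s <= F x.
Proof.
move=> fs; have := legendre_ge F s x; rewrite -(fineK fs) lee_fin.
by rewrite /legendre_fun; lra.
Qed.

Lemma pressure_tangent rho sbar t : linear_equilibrium (fun x => sbar * A x) rho ->
  (t - sbar) * a rho <= pressure_fun A t - pressure_fun A sbar.
Proof. by move=> /linear_equilibriumP[rhoT <-]; have := pressure_ge t rhoT; lra. Qed.

Lemma maximizer_le sbar t : legendre F sbar \is a fin_num -> legendre F t \is a fin_num ->
  maximizer (dual_functional A F) sbar ->
  pressure_fun A t - pressure_fun A sbar <= legendre_fun F t - legendre_fun F sbar.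
Proof.
move=> fs ft /(_ t); rewrite /dual_functional !pressureE -(fineK fs) -(fineK ft).
by rewrite -!EFinN -!EFinD lee_fin /legendre_fun; lra.
Qed.

Lemma equilibrium_derive rho sbar : legendre_differentiable F ->
  maximizer (dual_functional A F) sbar ->
  linear_equilibrium (fun x => sbar * A x) rho ->
  is_derive sbar 1 (pressure_fun A) (a rho) /\ derive1 (legendre_fun F) sbar = a rho.
Proof.
move=> [Ffin Fder] smax rhoE.
have fg t : (t - sbar) * a rho <= pressure_fun A t - pressure_fun A sbar <=
    legendre_fun F t - legendre_fun F sbar.
  by rewrite pressure_tangent//= maximizer_le.
split; first exact: squeezed_is_derive fg (Fder sbar).
rewrite derive1E; exact: squeezed_derive fg (Fder sbar).
Qed.

Lemma nonlinear_equilibrium_linear rho sbar : nonlinear_equilibrium A F rho ->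
  ((sbar * a rho)%:E - legendre F sbar =
     ereal_sup [set ((s * a rho)%R%:E - legendre F s)%E | s in [set: R]])%E ->
  unique_linear_equilibrium (fun x => sbar * A x) rho /\
  maximizer (dual_functional A F) sbar.
Proof.
move=> /nonlinear_equilibriumP[rhoT rhomax]; rewrite biconjugate// => sE.
have fs : legendre F sbar \is a fin_num.
  by move: sE; case: (legendre F sbar).
(* The attained supremum is the biconjugate [F (a rho)], so Fenchel-Young is an equality at
   [sbar]. *)
have LE : legendre_fun F sbar = sbar * a rho - F (a rho).
  by move: sE; rewrite -(fineK fs) -EFinB => -[]; rewrite /legendre_fun; lra.
have key t rho' : legendre F t \is a fin_num -> shift_invariant rho' ->
    t * a rho' + h rho' - legendre_fun F t <= sbar * a rho + h rho - legendre_fun F sbar.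
  move=> ft rho'T; have := fenchel_young (a rho') ft; have := rhomax _ rho'T.
  by rewrite LE; lra.
have rhoE : linear_equilibrium (fun x => sbar * A x) rho.
  apply/linear_equilibriumP; split => //; apply/eqP; rewrite eq_le pressure_ge//=.
  have [_ [mu [/linear_equilibriumP[muT <-] _]]] := hoelder_equilibrium (hoelder_potentialZ sbar).
  by have := key _ _ fs muT; rewrite lerD2r.
split; first exact: linear_equilibrium_unique.
move=> t; rewrite /dual_functional !pressureE.
(* The conjugate is at least - F 0, so where it is not finite it is [+oo] and the dual functional is
   [-oo]. *)
have [ft|] := boolP (legendre F t \is a fin_num); last first.
  have := legendre_ge F t 0; case: (legendre F t) => [r| |]//= _ _.
  by rewrite leNye.
rewrite -(fineK fs) -(fineK ft) -!EFinN -!EFinD lee_fin.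
have [_ [mu [/linear_equilibriumP[muT <-] _]]] := hoelder_equilibrium (hoelder_potentialZ t).
have /linear_equilibriumP[_ <-] := rhoE.
by have := key _ _ ft muT; rewrite /legendre_fun; lra.
Qed.

(** For a competitor rho', a subgradient s of F at rho' (A) gives equality in Fenchel-Young. The
    bound then combines the pressure inequality at s, maximality of [sbar] and Fenchel-Young at
    [sbar]. *)
Lemma linear_equilibrium_nonlinear rho sbar : (forall s, legendre F s \is a fin_num) ->
  maximizer (dual_functional A F) sbar ->
  linear_equilibrium (fun x => sbar * A x) rho ->
  nonlinear_equilibrium A F rho.
Proof.
move=> Ffin smax /linear_equilibriumP[rhoT rhoE].
apply/nonlinear_equilibriumP; split => // rho' rho'T.
have [s hs] := subgradient_exists hF (a rho').
have Ls : legendre_fun F s = s * a rho' - F (a rho').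
  by rewrite /legendre_fun (legendre_subgradient hs).
have h1 := pressure_ge s rho'T.
have h2 := maximizer_le (Ffin sbar) (Ffin s) smax.
have h3 := fenchel_young (a rho) (Ffin sbar).
by rewrite Ls -rhoE in h2; lra.
Qed.

End nonlinear_equilibria.

Theorem mainTheorem5 (R : realType) (d : nat) (A : shift_space R d -> R)
    (F : R -> R) (hA : hoelder_potential A)
    (hF : convex_function (E := R^o) setT F) :
  (forall (varpi : probability (shift_space R d) R) (sbar : R),
     nonlinear_equilibrium A F varpi ->
     ((sbar * \int[varpi]_x A x)%:E - legendre F sbar =
        ereal_sup [set ((s * \int[varpi]_x A x)%R%:E - legendre F s)%E
                  | s in [set: R]])%E ->
     [/\ unique_linear_equilibrium (fun x => sbar * A x) varpi,
         maximizer (dual_functional A F) sbar,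
         legendre_differentiable F ->
           [/\ derivable (pressure_fun A) sbar 1,
               \int[varpi]_x A x = derive1 (pressure_fun A) sbar &
               derive1 (pressure_fun A) sbar = derive1 (legendre_fun F) sbar]
       & legendre_differentiable F ->
         injective (derive1 (legendre_fun F)) ->
         forall chi : R -> R, cancel (derive1 (legendre_fun F)) chi ->
           let s := chi (\int[varpi]_x A x) in
           [/\ derivable (pressure_fun A) s 1,
               derive1 (pressure_fun A) s = \int[varpi]_x A x &
               unique_linear_equilibrium (fun x => s * A x) varpi]])
  /\
  (legendre_differentiable F ->
   injective (derive1 (legendre_fun F)) ->
   forall chi : R -> R, cancel (derive1 (legendre_fun F)) chi ->
   forall sbar : R, maximizer (dual_functional A F) sbar ->
   exists varpi : probability (shift_space R d) R,
     [/\ unique_linear_equilibrium (fun x => sbar * A x) varpi,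
         sbar = chi (\int[varpi]_x A x) &
         nonlinear_equilibrium A F varpi]).

Proof.
split.
  move=> varpi sbar varpiE sE.
  have [varpiU smax] := nonlinear_equilibrium_linear hA hF varpiE sE.
  have dP Fd := equilibrium_derive hA Fd smax varpiU.1.
  have dP1 (Fd : legendre_differentiable F) : derivable (pressure_fun A) sbar 1 /\
      derive1 (pressure_fun A) sbar = \int[varpi]_x A x.
    by have [[dv <-] _] := dP Fd; rewrite derive1E.
  split => // Fd; first by have [? ->] := dP1 Fd; split => //; rewrite (dP Fd).2.
  move=> _ chi chiK s.
  (* The derivative of the conjugate at [sbar] is [varpi (A)], and [chi] undoes it. *)
  have -> : s = sbar by rewrite /s -(dP Fd).2 chiK.
  by have [? ?] := dP1 Fd; split.
move=> Fd _ chi chiK sbar smax.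
have [_ [varpi varpiU]] := hoelder_equilibrium (hoelder_potentialZ hA sbar).
exists varpi; split => //.
  by rewrite -(equilibrium_derive hA Fd smax varpiU.1).2 chiK.
apply: (linear_equilibrium_nonlinear hA hF Fd.1 smax); exact: varpiU.1.
Qed.
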